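(* Let $(M,L)$ be a Finsler manifold with $n=\dim M>2$, and let $W_1,W_2,W$ be its projective deviation tensor, Weyl torsion tensor and Weyl curvature tensor. Then for all $\pi$-vector fields $\overline X,\overline Y,\overline Z$: (a) $W_2(\overline X,\overline Y)=\frac13\{(D^\circ_{\gamma\overline X}W_1)(\overline Y)-(D^\circ_{\gamma\overline Y}W_1)(\overline X)\}$; (b) $W(\overline X,\overline Y)\overline Z=(D^\circ_{\gamma\overline Z}W_2)(\overline X,\overline Y)$.
   Context: $M$ is a real paracompact $C^\infty$ manifold of dimension $n$; $\pi:\mathcal TM\to M$ is the bundle of nonzero tangent vectors; $\pi^{-1}(TM)\to\mathcal TM$ is the pullback of $TM$ by $\pi$. Sections of $\pi^{-1}(TM)$ are called $\pi$-vector fields and written $\overline X$; tensor fields on $\pi^{-1}(TM)$ are called $\pi$-tensor fields (scalar-valued covariant ones: $\pi$-forms). $\overline\eta$ is the $\pi$-vector field $\overline\eta(u)=(u,u)$. There is an exact sequence $0\to\pi^{-1}(TM)\xrightarrow{\gamma}T(\mathcal TM)\xrightarrow{\rho}\pi^{-1}(TM)\to0$, where $\gamma$ is the vertical lift $\gamma(u,w)=\frac{d}{dt}\big|_{t=0}(u+tw)$ and $\rho$ sends $X\in T_u(\mathcal TM)$ to $(u,d\pi(X))$. Put $J:=\gamma\circ\rho$. For a function $f$, $d_Jf(X)=(JX)\cdot f$. For a Finsler manifold $(M,L)$ with $E=\frac12L^2$: the canonical spray $G$ is the vector field with $i_G\,dd_JE=-dE$; the Barthel connection is $\Gamma=[J,G]$,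 i.e. $\Gamma(X)=[JX,G]-J[X,G]$; $h=\frac12(I+\Gamma)$, $v=\frac12(I-\Gamma)$. The horizontal map $\beta:\pi^{-1}(TM)\to T(\mathcal TM)$ sends $\overline X$ to the unique vector in the image of $h$ with $\rho(\beta\overline X)=\overline X$; $K:T(\mathcal TM)\to\pi^{-1}(TM)$ is determined by $\gamma\circ K=v$. The Berwald connection $D^\circ$ is the linear connection on $\pi^{-1}(TM)$ with $D^\circ_{\gamma\overline X}\overline Y=\rho[\gamma\overline X,\beta\overline Y]$ and $D^\circ_{\beta\overline X}\overline Y=K[\beta\overline X,\gamma\overline Y]$. For a $\pi$-tensor field $A$, $(\stackrel{2}{D^\circ}A)(\overline X,\overline Y,\dots):=(D^\circ_{\gamma\overline X}A)(\overline Y,\dots)$, and $\stackrel{2}{D^\circ}\stackrel{2}{D^\circ}A$ means $\stackrel{2}{D^\circ}$ applied to $\stackrel{2}{D^\circ}A$, the outer differentiation direction being the first argument. Curvature: $\mathbf K(X,Y)\overline Z=-D^\circ_XD^\circ_Y\overline Z+D^\circ_YD^\circ_X\overline Z+D^\circ_{[X,Y]}\overline Z$; $R^\circ(\overline X,\overline Y)\overline Z=\mathbf K(\beta\overline X,\beta\overline Y)\overline Z$; $\widehat R^\circ(\overline X,\overline Y)=R^\circ(\overline X,\overline Y)\overline\eta$; $H(\overline X)=\widehat R^\circ(\overline\eta,\overline X)$. Further $R_2(\overline X,\overline Y):=\mathrm{Tr}\{\overline Z\mapsto R^\circ(\overline X,\overline Z)\overline Y\}$, $R_1(\overline X):=\frac1{n-1}\{nR_2(\overline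 X,\overline\eta)+R_2(\overline\eta,\overline X)\}$, $k:=\frac1{n-1}R_2(\overline\eta,\overline\eta)$. With $\mathfrak U_{\overline X,\overline Y}\{A(\overline X,\overline Y)\}:=A(\overline X,\overline Y)-A(\overline Y,\overline X)$: Projective deviation tensor: $W_1(\overline X):=H(\overline X)-k\overline X+\frac1{n+1}\{3R_1(\overline X)-(n+1)D^\circ_{\gamma\overline X}k\}\overline\eta$. Weyl torsion tensor: $W_2(\overline X,\overline Y):=\widehat R^\circ(\overline X,\overline Y)+\frac1{n+1}\mathfrak U_{\overline X,\overline Y}\{R_1(\overline Y)\overline X+(D^\circ_{\gamma\overline X}R_1)(\overline Y)\overline\eta\}$. Weyl curvature tensor: $W(\overline X,\overline Y)\overline Z:=R^\circ(\overline X,\overline Y)\overline Z+\frac1{n+1}\mathfrak U_{\overline X,\overline Y}\{(\stackrel{2}{D^\circ}R_1)(\overline Z,\overline Y)\overline X+(\stackrel{2}{D^\circ}R_1)(\overline X,\overline Y)\overline Z+(\stackrel{2}{D^\circ}\stackrel{2}{D^\circ}R_1)(\overline Z,\overline X,\overline Y)\overline\eta\}$. *)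

(* Defs.v *)
From HB Require Import structures.
From mathcomp Require Import all_boot all_order all_algebra.
From mathcomp Require Import all_classical all_reals all_analysis.
Import Order.TTheory GRing.Theory Num.Theory.
Import numFieldNormedType.Exports.

Set Implicit Arguments.
Unset Strict Implicit.
Unset Printing Implicit Defensive.

Local Open Scope classical_set_scope.
Local Open Scope ring_scope.

Section Smooth.
Context {R : realType} {m : nat}.

Fixpoint diff_class (k : nat) (V : set 'rV[R]_m) (f : 'rV[R]_m -> R) : Prop :=
  match k with
  | 0 => forall x, V x -> {for x, continuous f}
  | k'.+1 => (forall x, V x -> differentiable f x) /\
             (forall v : 'rV[R]_m, diff_class k' V ('D_v f))
  end.

Definition smooth (V : set 'rV[R]_m) (f : 'rV[R]_m -> R) : Prop :=
  forall k, diff_class k V f.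

End Smooth.

(* [param c] is the local parametrization inverse to the chart [coord c]; the
   maps are total, and only [coord c] on [dom c] and [param c] on
   [coord c @` dom c] matter.  The record carries no axioms: these are in
   [smooth_manifold]. *)
Record atlas (R : realType) (m : nat) (S : Type) := Atlas {
  chart : Type;
  dom : chart -> set S;
  coord : chart -> S -> 'rV[R]_m;
  param : chart -> 'rV[R]_m -> S }.

Section Charts.
Context {R : realType} {m : nat} {S : Type} (A : atlas R m S).
Implicit Types (p : S) (f : S -> R) (c : chart A).

(* [V] is the image in the chart [c] of an open neighbourhood of [p]. *)
Definition chart_nbhd c p (V : set 'rV[R]_m) : Prop :=
  [/\ dom c p, open V, V (coord c p) & V `<=` coord c @` dom c].

Definition locally_at p (P : S -> Prop) : Prop :=
  exists c V, chart_nbhd c p V /\ forall x, V x -> P (param c x).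

Definition smooth_at p f : Prop :=
  exists c V, chart_nbhd c p V /\ smooth V (f \o param c).

(* Tangent vectors and derivations at [p] act on the functions that are smooth
   near [p].  As real functionals on all of [S -> R] they are normalized to
   vanish on the other functions, so that two of them are equal exactly when
   they agree on the functions smooth near [p]. *)
Definition on_smooth p (D : (S -> R) -> R) : (S -> R) -> R :=
  fun f => if `[< smooth_at p f >] then D f else 0.

(* The tangent vector  sum_i w_i d/dx^i  at [p], in the chart [c]. *)
Definition chart_vec c (w : 'rV[R]_m) p : (S -> R) -> R :=
  on_smooth p (fun f => 'D_w (f \o param c) (coord c p)).

Definition tangent p (v : (S -> R) -> R) : Prop :=
  exists c w, dom c p /\ v = chart_vec c w p.

End Charts.

Definition paracompact (M : topologicalType) : Prop :=
  forall U : set (set M),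
    (forall B, U B -> open B) -> (forall p : M, exists2 B, U B & B p) ->
  exists V : set (set M),
    [/\ (forall B, V B -> open B),
        (forall p : M, exists2 B, V B & B p),
        (forall B, V B -> exists2 C, U C & B `<=` C)
      & (forall p : M, exists2 N, nbhs p N &
           finite_set [set B | V B /\ B `&` N !=set0])].

Definition smooth_manifold (R : realType) (n : nat) (M : topologicalType)
    (A : atlas R n M) : Prop :=
  [/\ hausdorff_space M,
      paracompact M,
      (forall p : M, exists c : chart A, dom c p),
      (forall c : chart A,
        [/\ open (dom c), open (coord c @` dom c),
            (forall p, dom c p -> param c (coord c p) = p),
            {within dom c, continuous (coord c)}
          & {within coord c @` dom c, continuous (param c)}])
    & (forall (c d : chart A) (i : 'I_n),
        smooth (coord c @` (dom c `&` dom d))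
               (fun x => coord d (param c x) 0 i))].

(* The points (p, v) of TM are the pairs with [tangent A p v]. *)
Definition TB (R : realType) (M : Type) : Type := (M * ((M -> R) -> R))%type.

Section SlitTangentBundle.
Context {R : realType} {n : nat} {M : Type} (A : atlas R n M).

Definition slit : set (TB R M) :=
  [set u | tangent A u.1 u.2 /\ u.2 <> (fun=> 0)].

Definition slit_coord (c : chart A) (u : TB R M) : 'rV[R]_(n + n) :=
  row_mx (coord c u.1) (\row_i u.2 (fun p => coord c p 0 i)).

Definition slit_param (c : chart A) (z : 'rV[R]_(n + n)) : TB R M :=
  let p := param c (lsubmx z) in (p, chart_vec c (rsubmx z) p).

(* The charts (x^i, y^i) of the manifold of nonzero tangent vectors induced by
   the charts (x^i) of M. *)
Definition slit_atlas : atlas R (n + n) (TB R M) :=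
  @Atlas R (n + n) (TB R M) (chart A)
    (fun c => slit `&` [set u | dom c u.1]) slit_coord slit_param.

End SlitTangentBundle.

(* Vector fields on the slit tangent bundle, and pi-vector fields: the value
   at [u] is a tangent vector to the slit tangent bundle at [u], respectively
   a tangent vector to M at [u.1].  Values outside the slit tangent bundle are
   irrelevant. *)
Definition vfield (R : realType) (M : Type) : Type :=
  TB R M -> (TB R M -> R) -> R.
Definition pifield (R : realType) (M : Type) : Type :=
  TB R M -> (M -> R) -> R.

Definition is_vfield_at (R : realType) (n : nat) (M : Type) (A : atlas R n M)
    (u : TB R M) (X : vfield R M) : Prop :=
  locally_at (slit_atlas A) u (fun v => tangent (slit_atlas A) v (X v)) /\
  forall f, smooth_at (slit_atlas A) u f ->
    smooth_at (slit_atlas A) u (fun v => X v f).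

Definition is_pifield_at (R : realType) (n : nat) (M : Type) (A : atlas R n M)
    (u : TB R M) (X : pifield R M) : Prop :=
  locally_at (slit_atlas A) u (fun v => tangent A v.1 (X v)) /\
  forall f, smooth_at A u.1 f -> smooth_at (slit_atlas A) u (fun v => X v f).

Definition is_vfield (R : realType) (n : nat) (M : Type) (A : atlas R n M)
    (X : vfield R M) : Prop :=
  forall u, slit A u -> is_vfield_at A u X.

Definition is_pifield (R : realType) (n : nat) (M : Type) (A : atlas R n M)
    (X : pifield R M) : Prop :=
  forall u, slit A u -> is_pifield_at A u X.

(* The product of a function on the slit tangent bundle and a field, for both
   kinds of fields. *)
Definition fmul (R : realType) (M S : Type) (a : TB R M -> R)
    (X : TB R M -> (S -> R) -> R) : TB R M -> (S -> R) -> R :=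
  fun u f => a u * X u f.

Definition alt (T V : Type) (W : zmodType) (B : T -> T -> V -> W) (X Y : T) :
  V -> W := fun u => B X Y u - B Y X u.

Section Calculus.
Context {R : realType} {n : nat} {M : Type} (A : atlas R n M).
Implicit Types (X Y : vfield R M) (U V : pifield R M).

Definition act X (f : TB R M -> R) : TB R M -> R := fun u => X u f.

Definition bracket X Y : vfield R M := fun u =>
  on_smooth (slit_atlas A) u (fun f => X u (act Y f) - Y u (act X f)).

Definition eta : pifield R M := fun u => u.2.

Definition gamma U : vfield R M := fun u =>
  on_smooth (slit_atlas A) u
    (fun f => derive1 (fun t : R => f (u.1, fun g => u.2 g + t * U u g)) 0).

Definition rho X : pifield R M := fun u =>
  on_smooth A u.1 (fun g => X u (g \o fst)).

Definition J X : vfield R M := gamma (rho X).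

(* Omega = d d_J E, with  d w (X, Y) = X.w(Y) - Y.w(X) - w([X, Y]). *)
Definition energy (L : TB R M -> R) : TB R M -> R := fun u => 2^-1 * L u ^+ 2.
Definition dJ (f : TB R M -> R) X : TB R M -> R := act (J X) f.
Definition Omega (L : TB R M -> R) X Y : TB R M -> R := fun u =>
  X u (dJ (energy L) Y) - Y u (dJ (energy L) X) - dJ (energy L) (bracket X Y) u.

(* Regularity of L and of E along the zero section (C^0 and C^1) follows from
   these axioms by homogeneity. *)
Definition finsler (L : TB R M -> R) : Prop :=
  [/\ (forall u, slit A u -> 0 < L u) /\ (forall p, L (p, fun=> 0) = 0),
      (forall u, slit A u -> smooth_at (slit_atlas A) u L),
      (forall u (t : R), slit A u -> 0 < t ->
         L (u.1, fun g => t * u.2 g) = t * L u)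
    & (forall u X, slit A u -> is_vfield_at A u X ->
         (forall Y, is_vfield_at A u Y -> Omega L X Y u = 0) ->
         X u = (fun=> 0))].

Definition canonical_spray (L : TB R M -> R) (G : vfield R M) : Prop :=
  is_vfield A G /\
  forall u X, slit A u -> is_vfield_at A u X ->
    Omega L G X u = - act X (energy L) u.

Definition barthel (G : vfield R M) X : vfield R M :=
  fun u f => bracket (J X) G u f - J (bracket X G) u f.

Definition hproj (G : vfield R M) X : vfield R M :=
  fun u f => 2^-1 * (X u f + barthel G X u f).

Definition vproj (G : vfield R M) X : vfield R M :=
  fun u f => 2^-1 * (X u f - barthel G X u f).

(* Fields defined near a point are needed here, and not only global ones,
   because [tr] evaluates the curvature on local coordinate fields. *)
Definition horizontal_map (G : vfield R M) (beta : pifield R M -> vfield R M) :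
    Prop :=
  forall u U, slit A u -> is_pifield_at A u U ->
    [/\ is_vfield_at A u (beta U),
        (exists2 X, is_vfield_at A u X & beta U u = hproj G X u)
      & rho (beta U) u = U u].

Definition connector (G : vfield R M) (K : vfield R M -> pifield R M) : Prop :=
  forall u X, slit A u -> is_vfield_at A u X ->
    is_pifield_at A u (K X) /\ gamma (K X) u = vproj G X u.

(* The trace at [u] of a tensorial operator on pi-vector fields: its value is
   sum_i dx^i (F (d/dx^i)) for any chart (x^i) around [u.1]. *)
Definition coord_field (c : chart A) (i : 'I_n) : pifield R M :=
  fun u => chart_vec c (delta_mx 0 i) u.1.

Definition tr (F : pifield R M -> pifield R M) : TB R M -> R := fun u =>
  get [set t : R | exists c : chart A, dom c u.1 /\
        t = \sum_(i < n) F (coord_field c i) u (fun p => coord c p 0 i)].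

End Calculus.

Section Berwald.
Context {R : realType} {n : nat} {M : Type} (A : atlas R n M).
Context (beta : pifield R M -> vfield R M) (K : vfield R M -> pifield R M).
Implicit Types (X Y Z : pifield R M) (V : vfield R M).

(* The linear connection determined by its values in the vertical directions
   gamma X and in the horizontal directions beta X, through the splitting
   V = gamma (K V) + beta (rho V). *)
Definition berwald V Y : pifield R M := fun u f =>
  rho A (bracket A (gamma A (K V)) (beta Y)) u f
  + K (bracket A (beta (rho A V)) (gamma A Y)) u f.

(* Covariant derivatives of pi-tensor fields: [nabla_s_k] is for the
   scalar-valued, [nabla_v_k] for the vector-valued ones with k arguments. *)
Definition nabla_s1 V (w : pifield R M -> TB R M -> R) Y : TB R M -> R :=
  fun u => act V (w Y) u - w (berwald V Y) u.

Definition nabla_s2 V (w : pifield R M -> pifield R M -> TB R M -> R) Y Z :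
    TB R M -> R :=
  fun u => act V (w Y Z) u - w (berwald V Y) Z u - w Y (berwald V Z) u.

Definition nabla_v1 V (B : pifield R M -> pifield R M) Y : pifield R M :=
  fun u f => berwald V (B Y) u f - B (berwald V Y) u f.

Definition nabla_v2 V (B : pifield R M -> pifield R M -> pifield R M) Y Z :
    pifield R M :=
  fun u f => berwald V (B Y Z) u f - B (berwald V Y) Z u f
             - B Y (berwald V Z) u f.

Definition D2_1 (w : pifield R M -> TB R M -> R) X Y : TB R M -> R :=
  nabla_s1 (gamma A X) w Y.

Definition D2_2 (w : pifield R M -> pifield R M -> TB R M -> R) X Y Z :
    TB R M -> R :=
  nabla_s2 (gamma A X) w Y Z.

Definition curvature (V W : vfield R M) Z : pifield R M := fun u f =>
  - berwald V (berwald W Z) u f + berwald W (berwald V Z) u f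
  + berwald (bracket A V W) Z u f.

Definition Rcurv X Y Z : pifield R M := curvature (beta X) (beta Y) Z.
Definition Rhat X Y : pifield R M := Rcurv X Y eta.
Definition H X : pifield R M := Rhat eta X.

Definition R2 X Y : TB R M -> R := tr A (fun Z => Rcurv X Z Y).
Definition R1 X : TB R M -> R := fun u =>
  (n%:R - 1)^-1 * (n%:R * R2 X eta u + R2 eta X u).
Definition kscal : TB R M -> R := fun u => (n%:R - 1)^-1 * R2 eta eta u.

Definition W1 X : pifield R M := fun u f =>
  H X u f - fmul kscal X u f
  + (n%:R + 1)^-1 *
    fmul (fun v => 3 * R1 X v - (n%:R + 1) * act (gamma A X) kscal v) eta u f.

Definition W2 X Y : pifield R M := fun u f =>
  Rhat X Y u f
  + (n%:R + 1)^-1 *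
    alt (fun X' Y' u =>
           fmul (R1 Y') X' u f
           + fmul (nabla_s1 (gamma A X') R1 Y') eta u f) X Y u.

Definition Wcurv X Y Z : pifield R M := fun u f =>
  Rcurv X Y Z u f
  + (n%:R + 1)^-1 *
    alt (fun X' Y' u =>
           fmul (D2_1 R1 Z Y') X' u f
           + fmul (D2_1 R1 X' Y') Z u f
           + fmul (D2_2 (D2_1 R1) Z X' Y') eta u f) X Y u.

End Berwald.

(* Main.v *)
(* In a chart (x^i, y^i) the equation of the canonical spray and the nondegeneracy
   of the Hessian of E in y give G = y^i d/dx^i + g^i d/dy^i with g^i homogeneous of
   degree 2 in y (in the infinitesimal form of Euler's identity).  Hence
   D_{gamma X} acts on components as the vector field gamma X, D_{gamma X} eta = X,
   and the torsion R^(X, Y) = X^i Y^j r_ij has coefficients of degree 1 in y whose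
   derivatives d r_ij / d y^l are the coefficients of R.  So
   D_{gamma Z} R^ = R, and the Bianchi identity gives
   R^(X, Y) = 1/3 ((D_{gamma X} H)(Y) - (D_{gamma Y} H)(X)).
   The remaining terms of (a) and (b) match by the Leibniz rule; in (a) the terms in k
   cancel because its vertical second derivatives commute.  About R_1 and k only
   smoothness is used. *)
From Pilot Require Import Defs.
From mathcomp Require Import all_boot all_order all_algebra.
From mathcomp Require Import all_classical all_reals all_analysis.
From mathcomp Require Import ring lra.
Import Order.TTheory GRing.Theory Num.Theory.
Import numFieldNormedType.Exports.
(* Again, because the library hides [coord] of the atlas behind [vector.coord]. *)
Import Pilot.Defs.

Local Open Scope classical_set_scope.
Local Open Scope ring_scope.

Set Implicit Arguments.
Unset Strict Implicit.
Unset Printing Implicit Defensive.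

(** * Smooth functions on open sets of R^m *)

(** Fields are total functionals, meaningful only near some points, and the hypotheses also quantify
    over fields defined near a single point. The calculus therefore runs on a region of one chart,
    where a field amounts to its smooth component functions and every operation has a rule on
    components; an identity of tensors then becomes a polynomial identity between real numbers. The
    degree of g^i comes from the spray equation on d/dx^j, which reads G(dE/dy^j) = dE/dx^j.
    Applying the Euler field y^k d/dy^k to both sides shows that the Hessian of E contracted with
    y^k dg^i/dy^k - 2 g^i vanishes. The factor 1/3 counts copies of R^(X, Y). In H(Y) = R^(eta, Y)
    the derivation along gamma X also meets eta and produces R^(X, Y); exchanging X and Y produces a
    second copy, by antisymmetry; the Bianchi identity contracted with eta gives the third. The
    first-order terms in k left by -k Y cancel against those of the eta-term, because the latter
    carries the factor n + 1 against 1/(n + 1). *)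

Section SmoothFunctions.
Context {R : realType}.

Lemma near_open (m : nat) (V : set 'rV[R]_m) x :
  open V -> V x -> \forall y \near x, V y.
Proof. by move=> Vo Vx; apply: open_nbhs_nbhs. Qed.

Section OneDomain.
Context {m : nat}.
Implicit Types (V W : set 'rV[R]_m) (f g : 'rV[R]_m -> R) (x v : 'rV[R]_m).

Lemma derive_eq_on V f g x v : open V -> V x ->
  (forall y, V y -> f y = g y) -> 'D_v f x = 'D_v g x.
Proof.
move=> Vo Vx fg; apply: near_eq_derive.
near=> y; apply: fg; near: y; exact: near_open.
Unshelve. all: by end_near.
Qed.

(** Serves to pass differentiability between functions that agree only near a point: their
    difference falls under this case. *)
Lemma near_eq0_differentiable f x :
  (\forall y \near x, f y = 0) -> differentiable f x.
Proof.
move=> f0; have fx : f x = 0 by exact: nbhs_singleton f0.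
(* The zero map is obtained as a differential, so that it has the linear structure that
   [diff_unique] expects. *)
pose z := 'd (cst (0 : R)) x.
have z0 : z = (fun=> 0) :> ('rV[R]_m -> R) by rewrite /z diff_cst.
have e : f \o shift x = cst (f x) + z +o_ (0 : 'rV[R]_m) id.
  apply/eqaddoP => _/posnumP[e]; rewrite fx z0.
  have : \forall y \near (0 : 'rV[R]_m), f (y + x) = 0.
    by move: f0; rewrite (near_shift 0) /= subr0.
  apply: filterS => y fy /=.
  rewrite -![(_ + _ : _ -> _) _]/(_ + _) -![(- _ : _ -> _) _]/(- _) /= fy.
  by rewrite addr0 subr0 normr0 mulr_ge0.
have c0 : continuous z by apply: diff_continuous; exact: differentiable_cst.
apply/diff_locallyP; split; first by rewrite (diff_unique c0 e).
by rewrite (diff_unique c0 e).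
Qed.

Lemma differentiable_eq_on V f g x : open V -> V x ->
  (forall y, V y -> f y = g y) -> differentiable f x -> differentiable g x.
Proof.
move=> Vo Vx fg df.
have -> : g = f + (g - f) by rewrite addrC subrK.
apply: differentiableD => //; apply: near_eq0_differentiable.
near=> y.
have Vy : V y by near: y; exact: near_open.
by rewrite -[(_ + _ : _ -> _) _]/(_ + _) -![(- _ : _ -> _) _]/(- _) fg ?subrr.
Unshelve. all: by end_near.
Qed.

Lemma differentiable_for_eq_on V f g x : open V -> V x ->
  (forall y, V y -> f y = g y) -> {for x, continuous f} -> {for x, continuous g}.
Proof.
move=> Vo Vx fg; rewrite /prop_for /continuous_at -(fg x Vx).
move=> cf; apply: cvg_trans cf; apply: (@near_eq_cvg _ _ (nbhs x)).
near=> y.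
have Vy : V y by near: y; exact: near_open.
by rewrite fg.
Unshelve. all: by end_near.
Qed.

Lemma derive_sum_basis f x v : differentiable f x ->
  'D_v f x = \sum_i v 0 i * 'D_(delta_mx 0 i) f x.
Proof.
move=> df; rewrite [in LHS](row_sum_delta v) deriveE // linear_sum.
by apply: eq_bigr => i _; rewrite linearZ deriveE.
Qed.

Lemma derive_add f g x v : differentiable f x -> differentiable g x ->
  'D_v (fun y => f y + g y) x = 'D_v f x + 'D_v g x.
Proof. by move=> df dg; rewrite -deriveD //; exact: diff_derivable. Qed.

Lemma derive_mul f g x v : differentiable f x -> differentiable g x ->
  'D_v (fun y => f y * g y) x = 'D_v f x * g x + f x * 'D_v g x.
Proof.
move=> df dg.
rewrite (_ : (fun y => f y * g y) = f * g) // deriveM; try exact: diff_derivable.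
by rewrite addrC; congr (_ + _); rewrite [_ *: _]mulrC.
Qed.

Lemma diff_class_eq_on V k f g : open V ->
  (forall y, V y -> f y = g y) -> diff_class k V f -> diff_class k V g.
Proof.
move=> Vo; elim: k f g => [|k IHk] f g fg /=.
  by move=> cf x Vx; exact: (differentiable_for_eq_on Vo Vx fg (cf x Vx)).
move=> [df Df]; split.
  by move=> x Vx; apply: (differentiable_eq_on Vo Vx fg); apply: df.
by move=> v; apply: IHk (Df v) => x Vx; apply: derive_eq_on fg.
Qed.

Lemma smooth_eq_on V f g : open V ->
  (forall y, V y -> f y = g y) -> smooth V f -> smooth V g.
Proof. by move=> Vo fg sf k; apply: diff_class_eq_on (sf k). Qed.

Lemma smooth_differentiable V f x : smooth V f -> V x -> differentiable f x.
Proof. by move=> /(_ 1%N)[df _]; apply: df. Qed.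

Lemma smooth_derive V f v : smooth V f -> smooth V ('D_v f).
Proof. by move=> sf k; have [_] := sf k.+1; apply. Qed.

Lemma smooth_sub V W f : W `<=` V -> smooth V f -> smooth W f.
Proof.
move=> WV sf k; elim: k f sf => [|k IHk] f sf.
  by move=> x Wx; apply: (sf 0%N); apply: WV.
split=> [x Wx|v]; first by apply: (smooth_differentiable sf); apply: WV.
by apply: IHk; apply: smooth_derive.
Qed.

Lemma smooth_local V f :
  (forall x, V x -> exists W, [/\ open W, W x & smooth W f]) -> smooth V f.
Proof.
move=> loc k; elim: k f loc => [|k IHk] f loc.
  by move=> x /loc[W [_ Wx sf]]; apply: (sf 0%N).
split=> [x /loc[W [_ Wx sf]]|v]; first exact: smooth_differentiable sf Wx.
apply: IHk => x /loc[W [Wo Wx sf]]; exists W; split=> //.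
exact: smooth_derive.
Qed.

(** Induction on the order, for a whole class at once: a derivative may change the form of the
    function as long as it stays in P up to equality on V. *)
Lemma smooth_coind V (P : ('rV[R]_m -> R) -> Prop) : open V ->
  (forall f, P f -> (forall x, V x -> differentiable f x) /\
     forall v, exists2 g, P g & forall x, V x -> 'D_v f x = g x) ->
  forall f, P f -> smooth V f.
Proof.
move=> Vo hP f Pf k; elim: k f Pf => [|k IHk] f /hP[df Df].
  by move=> x /df; exact: differentiable_continuous.
split=> // v; have [g Pg gE] := Df v.
by apply: diff_class_eq_on (IHk g Pg) => // x Vx; rewrite gE.
Qed.

(** Derivatives of products and composites are polynomials in functions of the original kinds. In
    the generated algebra it is enough to control the derivatives of the generators
    ([smooth_generated]). *)
Inductive generated (Q : ('rV[R]_m -> R) -> Prop) : ('rV[R]_m -> R) -> Prop :=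
| generated_base f : Q f -> generated Q f
| generated_cst a : generated Q (fun=> a)
| generated_add f g :
    generated Q f -> generated Q g -> generated Q (fun x => f x + g x)
| generated_mul f g :
    generated Q f -> generated Q g -> generated Q (fun x => f x * g x).

Lemma generated_sum Q (I : Type) (r : seq I) (F : I -> 'rV[R]_m -> R) :
  (forall i, generated Q (F i)) -> generated Q (fun x => \sum_(i <- r) F i x).
Proof.
move=> QF; elim: r => [|i r IHr].
  rewrite (_ : (fun _ => _) = fun=> 0); first exact: generated_cst.
  by apply/funext => x; rewrite big_nil.
rewrite (_ : (fun _ => _) = fun x => F i x + \sum_(j <- r) F j x).
  exact: generated_add.
by apply/funext => x; rewrite big_cons.
Qed.

Lemma smooth_generated V Q : open V ->
  (forall f, Q f -> (forall x, V x -> differentiable f x) /\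
     forall v, exists2 g, generated Q g & forall x, V x -> 'D_v f x = g x) ->
  forall f, generated Q f -> smooth V f.
Proof.
move=> Vo hQ; apply: smooth_coind => // f.
elim=> {f} [f /hQ //|a|f g _ [df Df] _ [dg Dg]|f g Qf [df Df] Qg [dg Dg]].
- split=> [x _|v]; first exact: differentiable_cst.
  by exists (fun=> 0) => [|x _]; [exact: generated_cst|exact: derive_cst].
- split=> [x Vx|v]; first by apply: differentiableD; [apply: df|apply: dg].
  have [f' Qf' fE] := Df v; have [g' Qg' gE] := Dg v.
  exists (fun x => f' x + g' x) => [|x Vx]; first exact: generated_add.
  by rewrite derive_add ?fE ?gE //; [apply: df|apply: dg].
- split=> [x Vx|v]; first by apply: differentiableM; [apply: df|apply: dg].
  have [f' Qf' fE] := Df v; have [g' Qg' gE] := Dg v.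
  exists (fun x => f' x * g x + f x * g' x) => [|x Vx].
    by apply: generated_add; apply: generated_mul.
  by rewrite derive_mul ?fE ?gE //; [apply: df|apply: dg].
Qed.

Lemma smooth_algebra V f : open V -> generated (smooth V) f -> smooth V f.
Proof.
move=> Vo; apply: smooth_generated => // g sg.
split=> [x Vx|v]; first exact: smooth_differentiable sg Vx.
by exists ('D_v g) => //; apply: generated_base; apply: smooth_derive.
Qed.

Lemma derive_coord x v i : 'D_v (fun y : 'rV[R]_m => y 0 i) x = v 0 i.
Proof.
have := derive_mx (@derivable_id _ _ x v); rewrite derive_id => /matrixP/(_ 0 i).
by rewrite mxE => ->.
Qed.

Lemma smooth_coord V i : open V -> smooth V (fun x => x 0 i).
Proof.
move=> Vo; pose Q f := f = (fun x : 'rV[R]_m => x 0 i).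
apply: (smooth_generated (Q := Q)) => //; last exact: generated_base.
move=> f ->; split=> [x _|v]; first exact: differentiable_coord.
exists (fun=> v 0 i) => [|x _]; first exact: generated_cst.
exact: derive_coord.
Qed.

End OneDomain.

Section Composition.
Context {m k : nat}.
Implicit Types (V : set 'rV[R]_m) (W : set 'rV[R]_k).

Lemma differentiable_row (phi : 'rV[R]_m -> 'rV[R]_k) x :
  (forall i, differentiable (fun y => phi y 0 i) x) -> differentiable phi x.
Proof.
move=> dphi.
have -> : phi = \sum_(i < k) (fun y => phi y 0 i *: (delta_mx 0 i : 'rV[R]_k)).
  by apply/funext => y; rewrite fct_sumE [LHS]row_sum_delta.
apply: differentiable_sum => i.
by apply: differentiableZl; apply: dphi.
Qed.

Lemma derive_comp f (phi : 'rV[R]_m -> 'rV[R]_k) x v :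
  (forall i, differentiable (fun y => phi y 0 i) x) ->
  differentiable f (phi x) ->
  'D_v (f \o phi) x =
    \sum_i 'D_v (fun y => phi y 0 i) x * 'D_(delta_mx 0 i) f (phi x) :> R.
Proof.
move=> dphi df.
have dp := differentiable_row dphi.
rewrite deriveE; last exact: differentiable_comp.
rewrite diff_comp //= -deriveE // derive_sum_basis // -deriveE //.
apply: eq_bigr => i _; congr (_ * _).
by rewrite derive_mx ?mxE //; apply: diff_derivable.
Qed.

Lemma smooth_comp V W f (phi : 'rV[R]_m -> 'rV[R]_k) : open V -> open W ->
  (forall x, V x -> W (phi x)) ->
  (forall i, smooth V (fun x => phi x 0 i)) ->
  smooth W f -> smooth V (f \o phi).
Proof.
move=> Vo Wo VW sphi sf.
(* By the chain rule a derivative of a composite is a sum of products of derivatives of phi and of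
   new composites, so both kinds are taken as generators. *)
pose Q g := smooth V g \/ exists2 g', smooth W g' & g = g' \o phi.
have dphi x : V x -> forall i, differentiable (fun y => phi y 0 i) x.
  by move=> Vx i; apply: smooth_differentiable Vx.
apply: (smooth_generated (Q := Q)) => //; last first.
  by apply: generated_base; right; exists f.
move=> g [sg|[g' sg' ->]].
  split=> [x|v]; first exact: smooth_differentiable.
  by exists ('D_v g) => //; apply: generated_base; left; apply: smooth_derive.
split=> [x Vx|v].
  apply: differentiable_comp; first exact/differentiable_row/dphi.
  by apply: smooth_differentiable sg' _; apply: VW.
exists (fun x => \sum_i 'D_v (fun y => phi y 0 i) x *
                        ('D_(delta_mx 0 i) g' \o phi) x) => [|x Vx].
  apply: generated_sum => i; apply: generated_mul; apply: generated_base.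
    by left; apply: smooth_derive.
  by right; exists ('D_(delta_mx 0 i) g') => //; apply: smooth_derive.
rewrite derive_comp //; first exact: dphi.
by apply: smooth_differentiable sg' _; apply: VW.
Qed.

End Composition.

(** * Symmetry of mixed second derivatives *)

Section Schwarz.
Context {m : nat}.
Implicit Types (V : set 'rV[R]_m) (f : 'rV[R]_m -> R) (x v w : 'rV[R]_m).

Lemma derive_line f a v (s : R) : differentiable f (a + s *: v) ->
  is_derive s 1 (fun s : R => f (a + s *: v)) ('D_v f (a + s *: v)).
Proof.
move=> df.
have e : (fun h => h^-1 *: (((fun s : R => f (a + s *: v)) \o shift s) (h *: 1)
                             - f (a + s *: v))) =
         (fun h => h^-1 *: ((f \o shift (a + s *: v)) (h *: v) - f (a + s *: v))).
  apply/funext => h /=; congr (_ *: (f _ - _)).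
  by rewrite [h *: 1]mulr1 scalerDl addrCA.
have dv : derivable f (a + s *: v) v by exact: diff_derivable.
by split; rewrite /derivable /derive e.
Qed.

Lemma MVT_line f a v (c : R) : 0 < c ->
  (forall s, 0 <= s <= c -> differentiable f (a + s *: v)) ->
  exists2 s, 0 <= s <= c &
    f (a + c *: v) - f a = 'D_v f (a + s *: v) * c.
Proof.
move=> c0 df; pose h s := f (a + s *: v).
have dh s : 0 <= s <= c -> is_derive s 1 h ('D_v f (a + s *: v)).
  by move=> /df; exact: derive_line.
have [||s] := @MVT R h (fun s => 'D_v f (a + s *: v)) 0 c c0.
- by move=> s; rewrite in_itv /= => /andP[s0 sc]; apply: dh; rewrite !ltW.
- apply: derivable_within_continuous => s.
  by rewrite in_itv /= => /dh[].
rewrite in_itv /= => /andP[s0 sc]; rewrite subr0 /h scale0r addr0 => ->.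
by exists s => //; rewrite !ltW.
Qed.

(** The mean value theorem is used twice: along v for y -> f (y + c w) - f y, then along w for the
    derivative of f along v. The second difference itself is symmetric in v and w. *)
Lemma second_difference V f x v w (c : R) : 0 < c -> smooth V f ->
  (forall s t, 0 <= s <= c -> 0 <= t <= c -> V (x + s *: v + t *: w)) ->
  exists s t, [/\ 0 <= s <= c, 0 <= t <= c &
    f (x + c *: v + c *: w) - f (x + c *: v) - (f (x + c *: w) - f x) =
    'D_w ('D_v f) (x + s *: v + t *: w) * c * c].
Proof.
move=> c0 sf Vst.
have cc : 0 <= c <= c by rewrite lexx ltW.
have c00 : 0 <= (0 : R) <= c by rewrite lexx ltW.
pose g y := f (y + c *: w) - f y.
have shiftE y : 'D_v (fun z => f (z + c *: w)) y = 'D_v f (y + c *: w).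
  rewrite /derive; have -> : (fun h => h^-1 *: (((fun z => f (z + c *: w)) \o
      shift y) (h *: v) - f (y + c *: w))) =
      (fun h => h^-1 *: ((f \o shift (y + c *: w)) (h *: v) - f (y + c *: w))).
    by apply/funext => h /=; rewrite addrA.
  by [].
have dshift y : V (y + c *: w) -> differentiable (fun z => f (z + c *: w)) y.
  move=> Vy; apply: (@differentiable_comp _ _ _ _ (id + cst (c *: w)) f).
    by apply: differentiableD; [exact: ex_diff|exact: differentiable_cst].
  exact: smooth_differentiable Vy.
have V0 s : 0 <= s <= c -> V (x + s *: v).
  by move=> hs; have := Vst s 0 hs c00; rewrite scale0r addr0.
have dg s : 0 <= s <= c -> differentiable g (x + s *: v).
  move=> hs; apply: differentiableB; first exact/dshift/Vst.
  by apply: smooth_differentiable sf _; exact: V0.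
have [s hs es] := MVT_line c0 dg.
have [t|t ht et] := @MVT_line ('D_v f) (x + s *: v) w c c0.
  by move=> ht; apply: smooth_differentiable (Vst _ _ hs ht); apply: smooth_derive.
exists s, t; split=> //; rewrite -et.
rewrite -[LHS]/(g (x + c *: v) - g x) es; congr (_ * _).
rewrite /g deriveB ?shiftE //; apply: diff_derivable.
  exact/dshift/Vst.
by apply: smooth_differentiable sf _; exact: V0.
Qed.

Lemma continuous_ball V (F G : 'rV[R]_m -> R) x (e : R) : open V -> V x ->
  {for x, continuous F} -> {for x, continuous G} -> 0 < e ->
  exists2 r : R, 0 < r & forall y, ball_ Num.norm x r y ->
    [/\ V y, `|F x - F y| < e & `|G x - G y| < e].
Proof.
move=> Vo Vx cF cG e0.
have FF : Filter (nbhs x) by exact: nbhs_filter.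
have nF : \forall y \near x, `|F x - F y| < e by move/cvgrPdist_lt: cF; apply.
have nG : \forall y \near x, `|G x - G y| < e by move/cvgrPdist_lt: cG; apply.
have [r /= r0 hr] :=
  (nbhs_ballP _ _).1 (filterI (near_open Vo Vx) (filterI nF nG)).
exists r => // y xy; have [Vy [Fy Gy]] : (V `&` ([set y | `|F x - F y| < e] `&`
  [set y | `|G x - G y| < e])) y by apply: hr; rewrite -ball_normE.
by split.
Qed.

(** The second difference divided by c^2 is a value of either mixed derivative at some point near x.
    By continuity both mixed derivatives at x are then closer than |a - b| / 2 to one common value,
    which is absurd unless a = b. *)
Lemma schwarz V f x v w : open V -> V x -> smooth V f ->
  'D_v ('D_w f) x = 'D_w ('D_v f) x.
Proof.
move=> Vo Vx sf; apply/eqP; apply/negPn/negP => ne.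
set a := 'D_v _ _ in ne *; set b := 'D_w _ _ in ne *.
pose e := `|a - b| / 2.
have e0 : 0 < e by rewrite divr_gt0 // normr_gt0 subr_eq0.
have cont u u' : {for x, continuous ('D_u ('D_u' f))}.
  apply: differentiable_continuous.
  by apply: smooth_differentiable Vx; do 2 apply: smooth_derive.
have [r r0 hr] := continuous_ball Vo Vx (cont v w) (cont w v) e0.
(* Keeps x + s v + t w in the ball for 0 <= s, t <= c; the summand 1 makes the denominator positive
   and the bound strict. *)
pose c := r / (`|v| + `|w| + 1).
have d0 : 0 < `|v| + `|w| + 1 by rewrite ltr_wpDl // addr_ge0.
have c0 : 0 < c by rewrite divr_gt0.
have in_ball s t : 0 <= s <= c -> 0 <= t <= c ->
    ball_ Num.norm x r (x + s *: v + t *: w).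
  move=> /andP[s0 sc] /andP[t0 tc].
  rewrite /ball_ /= -addrA opprD addrA subrr sub0r normrN.
  apply: (le_lt_trans (ler_normD _ _)); rewrite !normrZ !ger0_norm //.
  apply: (@le_lt_trans _ _ (c * (`|v| + `|w|))).
    by rewrite mulrDr lerD // ler_wpM2r.
  by rewrite /c mulrAC ltr_pdivrMr // ltr_pM2l // ltrDl.
have [|s [t [hs ht es]]] := second_difference c0 sf (v := v) (w := w) (x := x).
  by move=> s t hs ht; have [] := hr _ (in_ball _ _ hs ht).
have in_ball' t' s' : 0 <= s' <= c -> 0 <= t' <= c ->
    ball_ Num.norm x r (x + t' *: w + s' *: v).
  by move=> hs' ht'; rewrite addrAC; exact: in_ball.
have [|t' [s' [ht' hs' es']]] := second_difference c0 sf (v := w) (w := v) (x := x).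
  by move=> t' s' ht' hs'; have [] := hr _ (in_ball' _ _ hs' ht').
have [_ _ hb] := hr _ (in_ball _ _ hs ht).
have [_ ha _] := hr _ (in_ball' _ _ hs' ht').
have eqD : 'D_w ('D_v f) (x + s *: v + t *: w) =
           'D_v ('D_w f) (x + t' *: w + s' *: v).
  apply: (mulIf (lt0r_neq0 c0)); apply: (mulIf (lt0r_neq0 c0)).
  apply: etrans (esym es) _; apply: etrans _ es'.
  have swap (A B C D : R) : A - B - (C - D) = A - C - (B - D) by ring.
  by rewrite [x + c *: w + c *: v]addrAC; exact: swap.
have : `|a - b| < e + e.
  have triangle (p q p' q' : R) : p = q -> `|p' - q| < e -> `|q' - p| < e ->
      `|p' - q'| < e + e.
    move=> -> pq qq; apply: le_lt_trans (ltrD pq qq).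
    by rewrite [`|q' - q|]distrC; exact: ler_distD.
  exact: triangle eqD ha hb.
by rewrite /e -splitr ltxx.
Qed.

End Schwarz.

End SmoothFunctions.

(** * Calculus in the charts of an atlas *)

Section AtlasCalculus.
Context {R : realType} {m : nat} {S : Type} (B : atlas R m S).
Implicit Types (c d : chart B) (p : S) (D : set S) (f g : S -> R).

(** S carries no topology, so openness is expressed through images in charts, here and in [region].
    This form also fits the slit tangent bundle, which is given by its atlas alone
    ([regular_slit]). *)
Definition regular : Prop :=
  [/\ forall c d, open (coord c @` (dom c `&` dom d)),
      forall c p, dom c p -> param c (coord c p) = p
    & forall c d i, smooth (coord c @` (dom c `&` dom d))
                           (fun x => coord d (param c x) 0 i)].

Definition chart_coord c (i : 'I_m) : S -> R := fun p => coord c p 0 i.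
Definition region c D : Prop := D `<=` dom c /\ open (coord c @` D).
Definition smooth_on c D f : Prop := smooth (coord c @` D) (f \o param c).
(* Locked: comparing two distinct partial derivatives up to conversion does not
   terminate in practice. *)
Fact partial_key : unit. Proof. exact: tt. Qed.
Definition partial c : 'I_m -> (S -> R) -> S -> R := locked_with partial_key
  (fun i f p => 'D_(delta_mx 0 i) (f \o param c) (coord c p)).

Lemma partialE c i f p :
  partial c i f p = 'D_(delta_mx 0 i) (f \o param c) (coord c p).
Proof. by rewrite /partial unlock. Qed.

Context (hB : regular).

Lemma paramK c p : dom c p -> param c (coord c p) = p.
Proof. by have [_ + _] := hB; apply. Qed.

Lemma region_image c D x : region c D -> (coord c @` D) x ->
  D (param c x) /\ coord c (param c x) = x.
Proof. by move=> [Dc _] [p Dp <-]; rewrite paramK //; apply: Dc. Qed.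

Lemma region_dom2 c d : region c (dom c `&` dom d).
Proof. by split=> [p []//|]; have [+ _ _] := hB; apply. Qed.

Lemma region_dom c : region c (dom c).
Proof. by have := region_dom2 c c; rewrite setIid. Qed.

Lemma region_preimage (k : nat) c D (h : S -> 'rV[R]_k) V : region c D -> open V ->
  (forall x, (coord c @` D) x -> {for x, continuous (h \o param c)}) ->
  region c (D `&` h @^-1` V).
Proof.
move=> rD Vo ch; have [Dc Do] := rD; split=> [p [/Dc]//|].
rewrite openE => _ [p [Dp Vp] <-].
have Wp : (coord c @` D) (coord c p) by exists p.
have nV : nbhs (coord c p) ((h \o param c) @^-1` V).
  by apply: ch => //=; rewrite paramK; [apply: near_open | apply: Dc].
move: (near_open Do Wp) nV; rewrite /interior; apply: filterS2 => x Wx /= Vx.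
by have [? ?] := region_image rD Wx; exists (param c x).
Qed.

Lemma region_cap c D D' : region c D -> region c D' -> region c (D `&` D').
Proof.
move=> rD rD'; have [Dc Do] := rD; have [Dc' Do'] := rD'.
split=> [p [/Dc]//|].
rewrite (_ : _ @` _ = coord c @` D `&` coord c @` D'); first exact: openI.
apply/seteqP; split=> [_ [p [Dp Dp'] <-]|x [Wx Wx']]; first by split; exists p.
have [Dp px] := region_image rD Wx; have [Dp' _] := region_image rD' Wx'.
by exists (param c x).
Qed.

Lemma smooth_on_at c D f p : region c D -> D p -> smooth_on c D f ->
  smooth_at B p f.
Proof.
move=> [Dc Do] Dp sf; exists c, (coord c @` D); split=> //.
split; [exact: Dc|exact: Do|by exists p|].
by move=> _ [q /Dc ? <-]; exists q.
Qed.

(** [smooth_at] and [locally_at] choose a chart of their own; continuity of the transition map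
    brings the neighbourhood into the prescribed chart c. *)
Lemma chart_nbhd_region c d p (V : set 'rV[R]_m) : dom c p -> chart_nbhd d p V ->
  exists D, [/\ region c D, D p, D `<=` dom d & forall q, D q -> V (coord d q)].
Proof.
move=> cp [dp Vo Vp Vd]; exists ((dom c `&` dom d) `&` coord d @^-1` V).
split=> [|//|q [[]]//|q []//].
apply: (region_preimage (region_dom2 c d) Vo).
move=> x Wx; apply: differentiable_continuous; apply: differentiable_row => i.
by have [_ _ /(_ c d i) sd] := hB; exact: smooth_differentiable sd Wx.
Qed.

Lemma smooth_at_on c f p : dom c p -> smooth_at B p f ->
  exists D, [/\ region c D, D p & smooth_on c D f].
Proof.
move=> cp [d [V [nV sf]]]; have [D [rD Dp Dd DV]] := chart_nbhd_region cp nV.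
have [Dc Do] := rD; have [_ Vo _ _] := nV.
exists D; split=> //.
apply: (@smooth_eq_on _ _ _ ((f \o param d) \o (coord d \o param c))) => //.
  by move=> x /(region_image rD)[/Dd dx _] /=; rewrite paramK.
apply: smooth_comp sf => // [x /(region_image rD)[/DV]//|i].
have [_ _ /(_ c d i)] := hB; apply: smooth_sub => _ [q Dq <-].
by exists q => //; split; [apply: Dc|apply: Dd].
Qed.

Lemma smooth_at_on_all (I : finType) (F : I -> S -> R) c p : dom c p ->
  (forall i, smooth_at B p (F i)) ->
  exists D, [/\ region c D, D p & forall i, smooth (coord c @` D) (F i \o param c)].
Proof.
move=> cp sF; suff [D [rD Dp sD]] : exists D, [/\ region c D, D p &
    forall i, i \in enum I -> smooth (coord c @` D) (F i \o param c)].
  by exists D; split=> // i; apply: sD; rewrite mem_enum.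
elim: (enum I) => [|i r [D [rD Dp sD]]].
  by exists (dom c); split=> //; exact: region_dom.
have [D' [rD' Dp' sD']] := smooth_at_on cp (sF i).
exists (D `&` D'); split=> //; first exact: region_cap.
move=> j; rewrite in_cons => /predU1P[->|/sD].
  by apply: smooth_sub sD' => _ [q [_ Dq] <-]; exists q.
by apply: smooth_sub => _ [q [Dq _] <-]; exists q.
Qed.

Lemma smooth_on_sub c D D' f : D' `<=` D -> smooth_on c D f -> smooth_on c D' f.
Proof. by move=> DD; apply: smooth_sub => _ [p /DD Dp <-]; exists p. Qed.

Lemma smooth_on_local c D f : region c D -> (forall p, D p -> smooth_at B p f) ->
  smooth_on c D f.
Proof.
move=> [Dc Do] sf; apply: smooth_local => _ [p Dp <-].
have [D' [[_ Do'] Dp' sf']] := smooth_at_on (Dc p Dp) (sf p Dp).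
by exists (coord c @` D'); split=> //; exists p.
Qed.

Lemma smooth_on_eq c D f g : region c D -> (forall p, D p -> f p = g p) ->
  smooth_on c D f -> smooth_on c D g.
Proof.
move=> rD fg; apply: smooth_eq_on; first by case: rD.
by move=> x /(region_image rD)[Dx _]; exact: fg.
Qed.

Lemma smooth_at_eq c D f g p : region c D -> D p -> (forall q, D q -> f q = g q) ->
  smooth_at B p f -> smooth_at B p g.
Proof.
move=> rD Dp fg sf; have [Dc _] := rD.
have [D' [rD' Dp' sf']] := smooth_at_on (Dc p Dp) sf.
apply: (@smooth_on_at c (D `&` D')) => //; first exact: region_cap.
apply: (@smooth_on_eq _ _ f); first exact: region_cap.
  by move=> q [/fg].
by apply: smooth_on_sub sf' => q [].
Qed.

Section SmoothOn.
Context {c : chart B} {D : set S} (rD : region c D).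

Let Do : open (coord c @` D). Proof. by case: rD. Qed.

Lemma smooth_on_cst (a : R) : smooth_on c D (fun=> a).
Proof. by apply: smooth_algebra => //; apply: generated_cst. Qed.

Lemma smooth_on_add f g : smooth_on c D f -> smooth_on c D g ->
  smooth_on c D (fun p => f p + g p).
Proof.
by move=> sf sg; apply: smooth_algebra => //; apply: generated_add;
  apply: generated_base.
Qed.

Lemma smooth_on_mul f g : smooth_on c D f -> smooth_on c D g ->
  smooth_on c D (fun p => f p * g p).
Proof.
by move=> sf sg; apply: smooth_algebra => //; apply: generated_mul;
  apply: generated_base.
Qed.

Lemma smooth_on_opp f : smooth_on c D f -> smooth_on c D (fun p => - f p).
Proof.
move=> sf; rewrite (_ : (fun _ => _) = fun p => -1 * f p).
  by apply: smooth_on_mul => //; apply: smooth_on_cst.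
by apply/funext => p; rewrite mulN1r.
Qed.

Lemma smooth_on_sub_fun f g : smooth_on c D f -> smooth_on c D g ->
  smooth_on c D (fun p => f p - g p).
Proof. by move=> sf sg; apply: smooth_on_add => //; apply: smooth_on_opp. Qed.

Lemma smooth_on_sum (I : Type) (r : seq I) (P : pred I) (F : I -> S -> R) :
  (forall i, smooth_on c D (F i)) ->
  smooth_on c D (fun p => \sum_(i <- r | P i) F i p).
Proof.
move=> sF; elim: r => [|i r IHr].
  rewrite (_ : (fun _ => _) = fun=> 0); first exact: smooth_on_cst.
  by apply/funext => p; rewrite big_nil.
rewrite (_ : (fun _ => _) = fun p => (if P i then F i p else 0) +
                                     \sum_(j <- r | P j) F j p).
  by apply: smooth_on_add => //; case: (P i) => //; apply: smooth_on_cst.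
by apply/funext => p; rewrite big_cons; case: ifP; rewrite ?add0r.
Qed.

Lemma smooth_on_partial i f : smooth_on c D f -> smooth_on c D (partial c i f).
Proof.
move=> sf; have sDf := smooth_derive (delta_mx 0 i) sf.
apply: smooth_eq_on sDf => // x Wx /=; rewrite partialE /=.
by have [_ ->] := region_image rD Wx.
Qed.

Lemma smooth_on_chart_coord i : smooth_on c D (chart_coord c i).
Proof.
apply: smooth_eq_on (smooth_coord i Do) => // x Wx /=.
by rewrite /chart_coord; have [_ ->] := region_image rD Wx.
Qed.

End SmoothOn.

Lemma smooth_at_chart_coord c i p : dom c p -> smooth_at B p (chart_coord c i).
Proof.
move=> cp; apply: (smooth_on_at (region_dom c) cp).
exact: (smooth_on_chart_coord (region_dom c)).
Qed.

Lemma partial_eq c D i f g p : region c D -> D p -> (forall q, D q -> f q = g q) ->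
  partial c i f p = partial c i g p.
Proof.
move=> rD Dp fg; have [_ Do] := rD; rewrite !partialE; apply: (derive_eq_on _ Do).
  by exists p.
by move=> x /(region_image rD)[Dx _]; exact: fg.
Qed.

Lemma partial_chart_coord c i j p : dom c p ->
  partial c i (chart_coord c j) p = (i == j)%:R.
Proof.
move=> cp; have [_ Do] := region_dom c.
rewrite partialE (derive_eq_on (g := fun x : 'rV[R]_m => x 0 j) _ Do).
- by rewrite derive_coord mxE eqxx eq_sym.
- by exists p.
- by move=> x /(region_image (region_dom c))[_ /= xE]; rewrite /chart_coord xE.
Qed.

Lemma partial_comm c D i j f p : region c D -> D p -> smooth_on c D f ->
  partial c i (partial c j f) p = partial c j (partial c i f) p.
Proof.
move=> rD Dp sf; have [_ Do] := rD.
have Wp : (coord c @` D) (coord c p) by exists p.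
have partial_onE k : forall x, (coord c @` D) x ->
    (partial c k f \o param c) x = 'D_(delta_mx 0 k) (f \o param c) x.
  by move=> x Wx; rewrite /= partialE; have [_ ->] := region_image rD Wx.
rewrite !(partialE _ _ (partial _ _ _)) (derive_eq_on _ Do Wp (partial_onE j)).
by rewrite (derive_eq_on _ Do Wp (partial_onE i)); exact: schwarz sf.
Qed.

(** * Tangent vectors as local derivations *)

Section TangentVectors.
Context {p : S} {v : (S -> R) -> R} (pv : tangent B p v).

Lemma tangent_not_smooth f : ~ smooth_at B p f -> v f = 0.
Proof.
by case: pv => c [w [_ ->]] /asboolPn/negbTE sf; rewrite /chart_vec /on_smooth sf.
Qed.

(** A tangent vector is given in one chart d; the chain rule through the transition map from d to c
    expands it in any chart c around p. *)
Lemma tangentE c f : dom c p -> smooth_at B p f ->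
  v f = \sum_i v (chart_coord c i) * partial c i f p.
Proof.
case: pv => d [w [dp ->]] cp sf.
have vE g : smooth_at B p g ->
    chart_vec d w p g = 'D_w (g \o param d) (coord d p).
  by move=> /asboolT sg; rewrite /chart_vec /on_smooth sg.
rewrite vE //.
have [D [rD Dp Df]] := smooth_at_on cp sf.
pose D' := (dom d `&` dom c) `&` D.
have [_ Do] := region_dom2 d c.
have Wp : (coord d @` (dom d `&` dom c)) (coord d p) by exists p.
have dphi i : differentiable (fun x => coord c (param d x) 0 i) (coord d p).
  by have [_ _ /(_ d c i) sd] := hB; exact: smooth_differentiable sd Wp.
transitivity ('D_w ((f \o param c) \o (coord c \o param d)) (coord d p)).
  apply: (derive_eq_on _ Do Wp) => x /(region_image (region_dom2 d c)).
  by move=> [[_ cx] _] /=; rewrite paramK.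
rewrite derive_comp //=; last first.
  by rewrite paramK //; apply: (smooth_differentiable Df); exists p.
apply: eq_bigr => i _; rewrite vE; last exact: smooth_at_chart_coord.
by rewrite partialE paramK.
Qed.

Lemma tangent_chart c : dom c p -> v = chart_vec c (\row_i v (chart_coord c i)) p.
Proof.
move=> cp; apply/funext => f; rewrite /chart_vec /on_smooth.
case: asboolP => [sf|]; last exact: tangent_not_smooth.
have [D [rD Dp Df]] := smooth_at_on cp sf.
rewrite (tangentE cp sf) derive_sum_basis; last first.
  by apply: (smooth_differentiable Df); exists p.
by apply: eq_bigr => i _; rewrite mxE partialE.
Qed.

(** If f is not smooth near p, neither is g, and both values are 0 by the normalization of tangent
    vectors. *)
Lemma tangent_eq_on c D f g : region c D -> D p -> (forall q, D q -> f q = g q) ->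
  v f = v g.
Proof.
move=> rD Dp fg; have cp : dom c p by case: rD => + _; apply.
have [sf|nsf] := pselect (smooth_at B p f).
  have sg := smooth_at_eq rD Dp fg sf.
  rewrite !(tangentE cp) //; apply: eq_bigr => i _.
  by rewrite (partial_eq _ rD Dp fg).
rewrite !tangent_not_smooth // => sg; apply: nsf.
by apply: (smooth_at_eq rD Dp _ sg) => q Dq; rewrite fg.
Qed.

Section Derivation.
Context {c : chart B} {D : set S} (rD : region c D) (Dp : D p).

Let cp : dom c p. Proof. by case: rD => + _; apply. Qed.
Let diff f : smooth_on c D f -> differentiable (f \o param c) (coord c p).
Proof. by move=> sf; apply: (smooth_differentiable sf); exists p. Qed.
Let at_p f : smooth_on c D f -> smooth_at B p f.
Proof. exact: smooth_on_at. Qed.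

Lemma tangent_add f g : smooth_on c D f -> smooth_on c D g ->
  v (fun q => f q + g q) = v f + v g.
Proof.
move=> sf sg; have sfg := smooth_on_add rD sf sg.
rewrite !(tangentE cp) //; try exact: at_p.
rewrite -big_split /=; apply: eq_bigr => i _; rewrite -mulrDr; congr (_ * _).
by rewrite !partialE; apply: derive_add; apply: diff.
Qed.

Lemma tangent_mul f g : smooth_on c D f -> smooth_on c D g ->
  v (fun q => f q * g q) = v f * g p + f p * v g.
Proof.
move=> sf sg; have sfg := smooth_on_mul rD sf sg.
rewrite !(tangentE cp) //; try exact: at_p.
rewrite mulr_suml mulr_sumr -big_split /=; apply: eq_bigr => i _.
rewrite !partialE (derive_mul _ (diff sf) (diff sg)) /= paramK //; ring.
Qed.

Lemma tangent_cst (a : R) : v (fun=> a) = 0.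
Proof.
rewrite (tangentE cp); last by apply: at_p; apply: smooth_on_cst.
by apply: big1 => i _; rewrite partialE derive_cst mulr0.
Qed.

Lemma tangent_opp f : smooth_on c D f -> v (fun q => - f q) = - v f.
Proof.
move=> sf; rewrite (_ : (fun _ => _) = fun q => -1 * f q); last first.
  by apply/funext => q; rewrite mulN1r.
rewrite tangent_mul //; last exact: smooth_on_cst.
by rewrite tangent_cst mul0r add0r mulN1r.
Qed.

Lemma tangent_sub f g : smooth_on c D f -> smooth_on c D g ->
  v (fun q => f q - g q) = v f - v g.
Proof.
by move=> sf sg; rewrite tangent_add ?tangent_opp //; apply: smooth_on_opp.
Qed.

Lemma tangent_sum (I : Type) (r : seq I) (F : I -> S -> R) :
  (forall i, smooth_on c D (F i)) ->
  v (fun q => \sum_(i <- r) F i q) = \sum_(i <- r) v (F i).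
Proof.
move=> sF; elim: r => [|i r IHr].
  rewrite big_nil (_ : (fun _ => _) = fun=> 0); first exact: tangent_cst.
  by apply/funext => q; rewrite big_nil.
rewrite big_cons -IHr -tangent_add //; last exact: smooth_on_sum.
by congr v; apply/funext => q; rewrite big_cons.
Qed.

End Derivation.

End TangentVectors.

Lemma tangent_chart_vec c w p : dom c p -> tangent B p (chart_vec c w p).
Proof. by move=> cp; exists c, w. Qed.

Lemma chart_vec_smooth c D w f p : region c D -> D p -> smooth_on c D f ->
  chart_vec c w p f = \sum_i w 0 i * partial c i f p.
Proof.
move=> rD Dp sf; rewrite /chart_vec /on_smooth asboolT; last first.
  exact: smooth_on_at sf.
rewrite derive_sum_basis; first by apply: eq_bigr => i _; rewrite partialE.
by apply: (smooth_differentiable sf); exists p.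
Qed.

Lemma chart_vec_chart_coord c w i p : dom c p ->
  chart_vec c w p (chart_coord c i) = w 0 i.
Proof.
move=> cp; rewrite (chart_vec_smooth _ (region_dom c)) //; last first.
  exact: smooth_on_chart_coord (region_dom c) i.
rewrite (bigD1 i) //= partial_chart_coord // eqxx mulr1 big1 ?addr0 // => j ji.
by rewrite partial_chart_coord // (negbTE ji) mulr0.
Qed.

(** Makes a partial derivative the value of a tangent vector, so that the rules for [partial] below
    are instances of those for derivations. *)
Lemma chart_vec_partial c D i f p : region c D -> D p -> smooth_on c D f ->
  chart_vec c (delta_mx 0 i) p f = partial c i f p.
Proof.
move=> rD Dp sf; rewrite /chart_vec /on_smooth asboolT ?partialE //.
exact: smooth_on_at sf.
Qed.

Section PartialDerivatives.
Context {c : chart B} {D : set S} {p : S} (rD : region c D) (Dp : D p) (i : 'I_m).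

Let tp : tangent B p (chart_vec c (delta_mx 0 i) p).
Proof. by apply: tangent_chart_vec; case: rD => + _; apply. Qed.

Lemma partial_add f g : smooth_on c D f -> smooth_on c D g ->
  partial c i (fun q => f q + g q) p = partial c i f p + partial c i g p.
Proof.
move=> sf sg; rewrite -!(chart_vec_partial _ rD Dp) //; last exact: smooth_on_add.
exact: (tangent_add tp rD Dp).
Qed.

Lemma partial_mul f g : smooth_on c D f -> smooth_on c D g ->
  partial c i (fun q => f q * g q) p = partial c i f p * g p + f p * partial c i g p.
Proof.
move=> sf sg; rewrite -!(chart_vec_partial _ rD Dp) //; last exact: smooth_on_mul.
exact: (tangent_mul tp rD Dp).
Qed.

Lemma partial_opp f : smooth_on c D f ->
  partial c i (fun q => - f q) p = - partial c i f p.
Proof.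
move=> sf; rewrite -!(chart_vec_partial _ rD Dp) //; last exact: smooth_on_opp.
exact: (tangent_opp tp rD Dp).
Qed.

Lemma partial_cst (a : R) : partial c i (fun=> a) p = 0.
Proof. by rewrite partialE derive_cst. Qed.

Lemma partial_sum (I : Type) (r : seq I) (F : I -> S -> R) :
  (forall j, smooth_on c D (F j)) ->
  partial c i (fun q => \sum_(j <- r) F j q) p = \sum_(j <- r) partial c i (F j) p.
Proof.
move=> sF; rewrite -(chart_vec_partial _ rD Dp); last exact: smooth_on_sum.
rewrite (tangent_sum tp rD Dp) //; apply: eq_bigr => j _.
by rewrite (chart_vec_partial _ rD Dp).
Qed.

End PartialDerivatives.

Lemma chart_vec_linear c p (a b : R) (v w : 'rV[R]_m) : dom c p ->
  (fun f => a * chart_vec c v p f + b * chart_vec c w p f) =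
  chart_vec c (a *: v + b *: w) p.
Proof.
move=> cp; apply/funext => f; rewrite /chart_vec /on_smooth.
case: asboolP => [sf|_]; last by rewrite !mulr0 addr0.
have [D [rD Dp Df]] := smooth_at_on cp sf.
have df : differentiable (f \o param c) (coord c p).
  by apply: (smooth_differentiable Df); exists p.
by rewrite !deriveE // linearD !linearZ.
Qed.

(** * Vector fields and their brackets in a chart *)

Definition field_on c D (X : S -> (S -> R) -> R) : Prop :=
  (forall p, D p -> tangent B p (X p)) /\
  forall i, smooth_on c D (fun p => X p (chart_coord c i)).

Lemma field_on_sub c D D' X : D' `<=` D -> field_on c D X -> field_on c D' X.
Proof.
move=> DD [tX sX]; split=> [p /DD|i]; first exact: tX.
exact: smooth_on_sub DD (sX i).
Qed.

Section Bracket.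
Context {c : chart B} {D : set S} (rD : region c D).

Lemma field_on_act X f : field_on c D X -> smooth_on c D f ->
  smooth_on c D (fun p => X p f).
Proof.
move=> [tX sX] sf; have [Dc _] := rD.
apply: (smooth_on_eq rD
  (f := fun p => \sum_i X p (chart_coord c i) * partial c i f p)).
  move=> p Dp; rewrite (tangentE (tX p Dp) (Dc p Dp)) //.
  exact: smooth_on_at sf.
by apply: smooth_on_sum => // i; apply: smooth_on_mul => //; apply: smooth_on_partial.
Qed.

(** Separates the second-order part. It is symmetric in X and Y once partial derivatives commute, so
    only the first-order part survives in [bracket_chart]. *)
Lemma second_derivative X Y f p : field_on c D X -> field_on c D Y ->
    smooth_on c D f -> D p ->
  X p (fun q => Y q f) =
    \sum_i X p (fun q => Y q (chart_coord c i)) * partial c i f p +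
    \sum_i \sum_j Y p (chart_coord c i) * X p (chart_coord c j) *
                   partial c j (partial c i f) p.
Proof.
move=> [tX sX] [tY sY] sf Dp; have [Dc _] := rD; have tXp := tX p Dp.
have spd i : smooth_on c D (partial c i f) by apply: smooth_on_partial.
rewrite (tangent_eq_on tXp rD
  (g := fun q => \sum_i Y q (chart_coord c i) * partial c i f q)) //.
  rewrite (tangent_sum tXp rD) // => [|i]; last exact: smooth_on_mul.
  rewrite -big_split /=; apply: eq_bigr => i _; rewrite (tangent_mul tXp rD) //.
  congr (_ + _); rewrite (tangentE tXp (Dc p Dp)); last exact: smooth_on_at (spd i).
  by rewrite mulr_sumr; apply: eq_bigr => j _; rewrite mulrA.
move=> q Dq; rewrite (tangentE (tY q Dq) (Dc q Dq)) //.
exact: smooth_on_at sf.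
Qed.

End Bracket.

Lemma bracket_chart c D X Y p : region c D -> field_on c D X -> field_on c D Y ->
    D p ->
  on_smooth B p (fun f => X p (fun q => Y q f) - Y p (fun q => X q f)) =
  chart_vec c (\row_i (X p (fun q => Y q (chart_coord c i)) -
                       Y p (fun q => X q (chart_coord c i)))) p.
Proof.
move=> rD fX fY Dp; apply/funext => f; have [Dc _] := rD.
rewrite /on_smooth; case: asboolP => [sf|nsf]; last first.
  rewrite (tangent_not_smooth _ nsf) //.
  by apply: tangent_chart_vec; apply: Dc.
have [D1 [rD1 D1p sf1]] := smooth_at_on (Dc p Dp) sf.
have rD' := region_cap rD rD1; have D'p : (D `&` D1) p by [].
have sub : D `&` D1 `<=` D by move=> q [].
have sf' : smooth_on c (D `&` D1) f by apply: smooth_on_sub sf1 => q [].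
have fX' := field_on_sub sub fX; have fY' := field_on_sub sub fY.
rewrite (chart_vec_smooth _ rD' D'p sf').
rewrite (second_derivative rD' fX' fY' sf' D'p).
rewrite (second_derivative rD' fY' fX' sf' D'p).
rewrite [X in _ - (_ + X)]exchange_big /=.
under [X in _ - (_ + X)]eq_bigr do under eq_bigr do
  rewrite (partial_comm _ _ rD' D'p sf') [X p _ * _]mulrC.
rewrite opprD addrACA subrr addr0 -sumrB; apply: eq_bigr => i _.
by rewrite mxE mulrBl.
Qed.

End AtlasCalculus.

(** * The slit tangent bundle *)

Lemma regular_of_manifold (R : realType) (n : nat) (M : topologicalType)
    (A : atlas R n M) : smooth_manifold A -> regular A.
Proof.
move=> [_ _ _ hc sd]; split=> // [c d|c p cp]; last first.
  by have [_ _ + _ _] := hc c; apply.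
have [Dc Co pK _ cparam] := hc c; have [Dd _ _ _ _] := hc d.
(* The image of the overlap is rewritten as a preimage under [param c], which is continuous on an
   open set. *)
rewrite (_ : _ @` _ = (coord c @` dom c) `&` param c @^-1` dom d); last first.
  apply/seteqP; split=> [_ [p [cp dp] <-]|_ [[p cp <-]]] /=.
    by split; [exists p | rewrite pK].
  by rewrite pK // => dp; exists p.
rewrite openE => x [Cx dx]; apply: filterI; first exact: near_open.
move: cparam; rewrite continuous_open_subspace // => /(_ x (mem_set Cx)).
by apply; apply: open_nbhs_nbhs.
Qed.

Section SlitBundle.
Context {R : realType} {n : nat} {M : Type} (A : atlas R n M) (hA : regular A).
Implicit Types (c d : chart A) (u v : TB R M) (D : set M).

Local Notation SA := (slit_atlas A).

Definition xcoord c (i : 'I_n) : TB R M -> R := fun u => coord c u.1 0 i.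
Definition ycoord c (i : 'I_n) : TB R M -> R := fun u => u.2 (chart_coord c i).

Lemma chart_coord_lshift c i : chart_coord (B := SA) c (lshift n i) = xcoord c i.
Proof. by apply/funext => u; rewrite /chart_coord /= /slit_coord row_mxEl. Qed.

Lemma chart_coord_rshift c i : chart_coord (B := SA) c (rshift n i) = ycoord c i.
Proof. by apply/funext => u; rewrite /chart_coord /= /slit_coord row_mxEr mxE. Qed.

Definition over (D : set M) : set (TB R M) := slit A `&` [set u | D u.1].

Lemma slit_paramK c u : slit A u -> dom c u.1 ->
  slit_param c (slit_coord c u) = u.
Proof.
case: u => p w [/= tw _] cp; rewrite /slit_param /slit_coord row_mxKl row_mxKr /=.
by rewrite (paramK hA) // -(tangent_chart hA tw cp).
Qed.

Lemma slit_coordK c D z : region c D -> (coord c @` D) (lsubmx z) ->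
  rsubmx z != 0 ->
  [/\ slit A (slit_param c z), D (slit_param c z).1 &
      slit_coord c (slit_param c z) = z].
Proof.
move=> rD Dz z0; have [Dp pz] := region_image hA rD Dz; have [Dc _] := rD.
have cp := Dc _ Dp.
have vE : \row_i chart_vec c (rsubmx z) (param c (lsubmx z)) (chart_coord c i) =
    rsubmx z.
  by apply/rowP => i; rewrite mxE chart_vec_chart_coord.
split=> //.
  split; first exact: tangent_chart_vec.
  move=> v0; move: z0; rewrite -vE (_ : \row_i _ = 0) ?eqxx //.
  by apply/rowP => i; rewrite !mxE; rewrite /= in v0; rewrite v0.
by rewrite /slit_coord /= pz vE hsubmxK.
Qed.

(** A tangent vector is nonzero exactly when its second block of coordinates is, and this is an open
    condition. *)
Lemma over_image c D : region c D -> slit_coord c @` over D =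
  (lsubmx @^-1` (coord c @` D)) `&` [set z | rsubmx z != 0].
Proof.
move=> rD; have [Dc _] := rD; apply/seteqP; split.
  move=> _ [u [su Du] <-]; rewrite /slit_coord; split=> /=.
    by rewrite row_mxKl; exists u.1.
  rewrite row_mxKr; apply/eqP => u0; have [tu] := su; apply.
  rewrite (tangent_chart hA tu (Dc _ Du)) u0; apply/funext => f.
  rewrite /chart_vec /on_smooth; case: asboolP => // sf.
  by rewrite derive0.
move=> z [Dz z0]; have [su Du zE] := slit_coordK rD Dz z0.
by exists (slit_param c z).
Qed.

Lemma over_open c D : region c D -> open (slit_coord c @` over D).
Proof.
move=> rD; rewrite (over_image rD); have [_ Do] := rD; apply: openI.
  by apply: open_comp => // z _; exact: continuous_lsubmx.
rewrite (_ : [set z | _] = rsubmx @^-1` (~` [set 0])); last first.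
  by apply/seteqP; split=> z /= /eqP.
apply: open_comp => [z _|]; first exact: continuous_rsubmx.
by rewrite openC; apply: accessible_closed_set1;
  apply: hausdorff_accessible; apply: norm_hausdorff.
Qed.

Lemma region_over c D : region c D -> region (B := SA) c (over D).
Proof.
move=> rD; split; last exact: over_open.
by have [Dc _] := rD; move=> u [su /Dc].
Qed.

Lemma slit_lsubmx c D z : region c D -> (slit_coord c @` over D) z ->
  (coord c @` D) (lsubmx z).
Proof. by move=> rD; rewrite over_image // => -[]. Qed.

Lemma smooth_lsubmx V (i : 'I_n) : open V ->
  smooth V (fun z : 'rV[R]_(n + n) => lsubmx z 0 i).
Proof.
move=> Vo; rewrite (_ : (fun _ => _) = (fun z : 'rV[R]_(n + n) => z 0 (lshift n i))).
  exact: smooth_coord.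
by apply/funext => z; rewrite mxE.
Qed.

Lemma smooth_comp_lsubmx (W : set 'rV[R]_n) V f : open W -> open V ->
  (forall z, V z -> W (lsubmx z)) -> smooth W f ->
  smooth V (fun z : 'rV[R]_(n + n) => f (lsubmx z)).
Proof.
move=> Wo Vo VW; apply: (smooth_comp (phi := lsubmx)) => // i.
exact: smooth_lsubmx.
Qed.

(** The transition maps are (x, y) -> (phi(x), dphi_x(y)). The second block is a sum of products of
    y^k with derivatives of phi at x, hence smooth. *)
Lemma regular_slit : regular SA.
Proof.
have oE c d : dom (a := SA) c `&` dom (a := SA) d = over (dom c `&` dom d).
  by apply/seteqP; split=> u; [move=> [[? ?] [_ ?]]|move=> [? [? ?]]].
split=> [c d|c u [su cu]|c d i]; first by rewrite oE; exact/over_open/region_dom2.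
  exact: slit_paramK.
rewrite oE; have Vo := over_open (region_dom2 hA c d).
have [_ Wo] := region_dom2 hA c d.
have VW := slit_lsubmx (region_dom2 hA c d).
have [_ _ sd] := hA.
case: (splitP i) => j ij.
  have -> : i = lshift n j by apply: val_inj.
  apply: (smooth_eq_on Vo _ (smooth_comp_lsubmx Wo Vo VW (sd c d j))) => z _ /=.
  by rewrite /slit_coord row_mxEl.
have -> : i = rshift n j by apply: val_inj.
pose phi x := @coord _ _ _ A d (@param _ _ _ A c x) 0 j.
have sphi k :
    smooth (@slit_coord _ _ _ A c @` over (@dom _ _ _ A c `&` @dom _ _ _ A d))
      (fun z => 'D_(delta_mx 0 k) phi (lsubmx z)).
  exact: (smooth_comp_lsubmx Wo Vo VW (smooth_derive (delta_mx 0 k) (sd c d j))).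
apply: (@smooth_eq_on _ _ _ (fun z => \sum_(k <- enum 'I_n)
    z 0 (rshift n k) * 'D_(delta_mx 0 k) phi (lsubmx z))) => //.
  move=> z Vz; rewrite /= /slit_coord row_mxEr mxE /=.
  have := VW _ Vz => /(region_image hA (region_dom2 hA c d))[Dp xE].
  rewrite /chart_vec /on_smooth asboolT; last first.
    by apply: (smooth_at_chart_coord hA j); case: Dp.
  rewrite xE [RHS]derive_sum_basis /=; last first.
    by apply: smooth_differentiable (sd c d j) _; apply: VW.
  by rewrite big_enum /=; apply: eq_bigr => k _; rewrite mxE.
apply: smooth_algebra => //; apply: generated_sum => k.
by apply: generated_mul; apply: generated_base => //; exact: smooth_coord.
Qed.

Let hSA := regular_slit.

Lemma smooth_on_fst c (E : set M) g : region c E -> smooth_on c E g ->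
  smooth_on (B := SA) c (over E) (fun u => g u.1).
Proof.
move=> rE sg; have [_ Eo] := rE.
apply: (smooth_comp_lsubmx (W := coord c @` E) Eo (over_open rE) _ sg) => z.
exact: slit_lsubmx.
Qed.

Lemma smooth_at_fst c u g : slit A u -> dom c u.1 -> smooth_at A u.1 g ->
  smooth_at SA u (fun v => g v.1).
Proof.
move=> su cu sg; have [E [rE Eu sgE]] := smooth_at_on hA cu sg.
exact: smooth_on_at (region_over rE) (conj su Eu) (smooth_on_fst rE sgE).
Qed.

Lemma partial_fst c (I : 'I_(n + n)) u g : slit A u -> dom c u.1 ->
    smooth_at A u.1 g ->
  partial (B := SA) c I (fun v => g v.1) u =
    \sum_j (lshift n j == I)%:R * partial c j g u.1.
Proof.
move=> su cu sg; have [E [rE Eu sgE]] := smooth_at_on hA cu sg.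
have xE : lsubmx (slit_coord c u) = coord c u.1 by rewrite row_mxKl.
rewrite partialE (_ : _ \o _ = (g \o param c) \o lsubmx) // derive_comp => [|i|].
- apply: eq_bigr => j _; rewrite xE partialE; congr (_ * _).
  rewrite (_ : (fun _ => _) = (fun z : 'rV[R]_(n + n) => z 0 (lshift n j))).
    by rewrite derive_coord mxE eqxx.
  by apply/funext => z; rewrite mxE.
- rewrite (_ : (fun _ => _) = (fun z : 'rV[R]_(n + n) => z 0 (lshift n i))).
    exact: differentiable_coord.
  by apply/funext => z; rewrite mxE.
- by rewrite xE; apply: (smooth_differentiable sgE); exists u.1.
Qed.

(** A function of the base point does not vary with y, so the y-part of the expansion drops out.
    This is what computes [rho]. *)
Lemma tangent_fst c u (t : (TB R M -> R) -> R) g : tangent SA u t -> slit A u ->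
    dom c u.1 -> smooth_at A u.1 g ->
  t (fun w => g w.1) = \sum_k t (xcoord c k) * partial c k g u.1.
Proof.
move=> tv su cu sg.
rewrite (tangentE hSA tv (conj su cu : dom (a := SA) c u)); last first.
  exact: (smooth_at_fst su cu sg).
rewrite big_split_ord /= [X in _ + X]big1 ?addr0 => [|i _]; last first.
  rewrite partial_fst // big1 ?mulr0 // => j _.
  by rewrite eq_lrshift mul0r.
apply: eq_bigr => i _; rewrite chart_coord_lshift; congr (_ * _).
rewrite partial_fst // (bigD1 i) //= eqxx mul1r big1 ?addr0 // => j ji.
by rewrite (inj_eq (@lshift_inj _ _)) (negbTE ji) mul0r.
Qed.

(** The tangent vector a^i d/dx^i + b^i d/dy^i in the induced chart; [pivec] is the pi-vector a^i
    d/dx^i. *)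
Definition vec c (a b : 'I_n -> R) : TB R M -> (TB R M -> R) -> R :=
  chart_vec (A := SA) c (row_mx (\row_i a i) (\row_i b i)).

Definition pivec c (a : 'I_n -> R) u : (M -> R) -> R :=
  chart_vec (A := A) c (\row_i a i) u.1.

Definition dx c i f u : R := partial (B := SA) c (lshift n i) f u.
Definition dy c i f u : R := partial (B := SA) c (rshift n i) f u.

(** * Components of fields in an induced chart *)

Section Components.
Context {c : chart A} {D : set (TB R M)} (rD : region (B := SA) c D).
Implicit Types (a b : 'I_n -> TB R M -> R) (p q : 'I_n -> R).
Implicit Types (X Y : vfield R M) (U : pifield R M).

Local Notation sm f := (smooth_on (B := SA) c D f).

Lemma region_slit u : D u -> slit A u.
Proof. by have [+ _] := rD => /[apply] -[]. Qed.

Lemma region_base u : D u -> dom c u.1.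
Proof. by have [+ _] := rD => /[apply] -[]. Qed.

(** The dictionary between fields and components. Components are explicit data rather than values of
    X on coordinates, so that each operation can return them in closed form and [vf_comps_eq] can
    simplify them on D. *)
Definition vf_comps X a b : Prop :=
  [/\ forall i, sm (a i), forall i, sm (b i)
    & forall u, D u -> X u = vec c (a^~ u) (b^~ u) u].

Definition pi_comps U a : Prop :=
  (forall i, sm (a i)) /\ forall u, D u -> U u = pivec c (a^~ u) u.

Lemma vec_xcoord p q i u : D u -> vec c p q u (xcoord c i) = p i.
Proof.
move=> Du; rewrite -chart_coord_lshift /vec (chart_vec_chart_coord hSA).
  by rewrite row_mxEl mxE.
by have [+ _] := rD; apply.
Qed.

Lemma vec_ycoord p q i u : D u -> vec c p q u (ycoord c i) = q i.
Proof.
move=> Du; rewrite -chart_coord_rshift /vec (chart_vec_chart_coord hSA).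
  by rewrite row_mxEr mxE.
by have [+ _] := rD; apply.
Qed.

Lemma pivec_chart_coord p i u : D u -> pivec c p u (chart_coord c i) = p i.
Proof. by move=> /region_base cu; rewrite /pivec (chart_vec_chart_coord hA) // mxE. Qed.

Lemma smooth_on_xcoord i : sm (xcoord c i).
Proof. by rewrite -chart_coord_lshift; apply: smooth_on_chart_coord. Qed.

Lemma smooth_on_ycoord i : sm (ycoord c i).
Proof. by rewrite -chart_coord_rshift; apply: smooth_on_chart_coord. Qed.

Lemma smooth_on_dx i f : sm f -> sm (dx c i f).
Proof. exact: (smooth_on_partial hSA rD). Qed.

Lemma smooth_on_dy i f : sm f -> sm (dy c i f).
Proof. exact: (smooth_on_partial hSA rD). Qed.

Lemma dx_ycoord i j u : D u -> dx c i (ycoord c j) u = 0.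
Proof.
have [Dc _] := rD => /Dc Du.
by rewrite /dx -chart_coord_rshift (partial_chart_coord hSA) // eq_lrshift.
Qed.

Lemma dy_ycoord i j u : D u -> dy c i (ycoord c j) u = (i == j)%:R.
Proof.
have [Dc _] := rD => /Dc Du.
rewrite /dy -chart_coord_rshift (partial_chart_coord hSA) //.
by rewrite (inj_eq (@rshift_inj _ _)).
Qed.

Lemma dx_eq i f g u : D u -> (forall v, D v -> f v = g v) ->
  dx c i f u = dx c i g u.
Proof. by move=> Du; exact: (partial_eq hSA _ rD Du). Qed.

Lemma dx_mul i f g u : D u -> sm f -> sm g ->
  dx c i (fun v => f v * g v) u = dx c i f u * g u + f u * dx c i g u.
Proof. by move=> Du; exact: (partial_mul hSA rD Du). Qed.

Lemma dx_cst i (k : R) u : dx c i (fun=> k) u = 0.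
Proof. exact: partial_cst. Qed.

Lemma dx_sum i (I : Type) (r : seq I) (F : I -> TB R M -> R) u : D u ->
  (forall j, sm (F j)) ->
  dx c i (fun v => \sum_(j <- r) F j v) u = \sum_(j <- r) dx c i (F j) u.
Proof. by move=> Du; exact: (partial_sum hSA rD Du). Qed.

Lemma dy_eq i f g u : D u -> (forall v, D v -> f v = g v) ->
  dy c i f u = dy c i g u.
Proof. by move=> Du; exact: (partial_eq hSA _ rD Du). Qed.

Lemma dy_add i f g u : D u -> sm f -> sm g ->
  dy c i (fun v => f v + g v) u = dy c i f u + dy c i g u.
Proof. by move=> Du; exact: (partial_add hSA rD Du). Qed.

Lemma dy_mul i f g u : D u -> sm f -> sm g ->
  dy c i (fun v => f v * g v) u = dy c i f u * g u + f u * dy c i g u.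
Proof. by move=> Du; exact: (partial_mul hSA rD Du). Qed.

Lemma dy_opp i f u : D u -> sm f -> dy c i (fun v => - f v) u = - dy c i f u.
Proof. by move=> Du; exact: (partial_opp hSA rD Du). Qed.

Lemma dy_cst i (k : R) u : dy c i (fun=> k) u = 0.
Proof. exact: partial_cst. Qed.

Lemma dy_sum i (I : Type) (r : seq I) (F : I -> TB R M -> R) u : D u ->
  (forall j, sm (F j)) ->
  dy c i (fun v => \sum_(j <- r) F j v) u = \sum_(j <- r) dy c i (F j) u.
Proof. by move=> Du; exact: (partial_sum hSA rD Du). Qed.

Lemma dy_comm i j f u : D u -> sm f -> dy c i (dy c j f) u = dy c j (dy c i f) u.
Proof. by move=> Du; exact: (partial_comm hSA _ _ rD Du). Qed.

Lemma dx_dy_comm i j f u : D u -> sm f ->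
  dx c i (dy c j f) u = dy c j (dx c i f) u.
Proof. by move=> Du; exact: (partial_comm hSA _ _ rD Du). Qed.

Lemma tangent_split u (t : (TB R M -> R) -> R) f : tangent SA u t -> D u -> sm f ->
  t f = \sum_i t (xcoord c i) * dx c i f u + \sum_i t (ycoord c i) * dy c i f u.
Proof.
move=> tu Du sf; have [Dc _] := rD.
rewrite (tangentE hSA tu (Dc _ Du)); last exact: smooth_on_at sf.
rewrite big_split_ord; congr (_ + _); apply: eq_bigr => i _.
  by rewrite chart_coord_lshift.
by rewrite chart_coord_rshift.
Qed.

Lemma tangent_vec u (t : (TB R M -> R) -> R) : tangent SA u t -> D u ->
  t = vec c (fun i => t (xcoord c i)) (fun i => t (ycoord c i)) u.
Proof.
move=> tu Du; have [Dc _] := rD; apply: etrans (tangent_chart hSA tu (Dc _ Du)) _.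
apply: (congr1 (fun w => chart_vec (A := SA) c w u)); apply/rowP => I.
rewrite mxE; case: (splitP I) => j Ij.
  have -> : I = lshift n j by apply: val_inj.
  by rewrite row_mxEl mxE chart_coord_lshift.
have -> : I = rshift n j by apply: val_inj.
by rewrite row_mxEr mxE chart_coord_rshift.
Qed.

Lemma tangent_pivec u (t : (M -> R) -> R) : tangent A u.1 t -> D u ->
  t = pivec c (fun i => t (chart_coord c i)) u.
Proof. by move=> tu /region_base cu; exact: (tangent_chart hA tu cu). Qed.

Lemma vec_tangent p q u : D u -> tangent SA u (vec c p q u).
Proof. by move=> Du; apply: tangent_chart_vec; case: rD => + _; apply. Qed.

Lemma pivec_tangent p u : D u -> tangent A u.1 (pivec c p u).
Proof. by move=> Du; apply: tangent_chart_vec; apply: region_base. Qed.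

Lemma vf_comps_tangent X a b u : vf_comps X a b -> D u -> tangent SA u (X u).
Proof. by move=> [_ _ XE] Du; rewrite XE //; apply: vec_tangent. Qed.

Lemma pi_comps_tangent U a u : pi_comps U a -> D u -> tangent A u.1 (U u).
Proof. by move=> [_ UE] Du; rewrite UE //; apply: pivec_tangent. Qed.

Lemma vf_comps_xcoord X a b i u : vf_comps X a b -> D u -> X u (xcoord c i) = a i u.
Proof. by move=> [_ _ XE] Du; rewrite XE // vec_xcoord. Qed.

Lemma vf_comps_ycoord X a b i u : vf_comps X a b -> D u -> X u (ycoord c i) = b i u.
Proof. by move=> [_ _ XE] Du; rewrite XE // vec_ycoord. Qed.

Lemma pi_comps_chart_coord U a i u : pi_comps U a -> D u -> U u (chart_coord c i) = a i u.
Proof. by move=> [_ UE] Du; rewrite UE // pivec_chart_coord. Qed.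

Lemma vf_comps_act X a b f u : vf_comps X a b -> D u -> sm f ->
  X u f = \sum_i a i u * dx c i f u + \sum_i b i u * dy c i f u.
Proof.
move=> Xab Du sf; rewrite (tangent_split (vf_comps_tangent Xab Du)) //.
congr (_ + _); apply: eq_bigr => i _; first by rewrite (vf_comps_xcoord i Xab).
by rewrite (vf_comps_ycoord i Xab).
Qed.

Lemma vertical_act X b f u : vf_comps X (fun _ _ => 0) b -> D u -> sm f ->
  X u f = \sum_i b i u * dy c i f u.
Proof.
move=> Xb Du sf; rewrite (vf_comps_act Xb Du sf).
by rewrite [X in X + _]big1 => [|i _]; [rewrite add0r|rewrite mul0r].
Qed.

Lemma vf_comps_field X a b : vf_comps X a b -> field_on (B := SA) c D X.
Proof.
move=> Xab; have [sa sb _] := Xab; split=> [u|I]; first exact: (vf_comps_tangent Xab).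
case: (splitP I) => j Ij.
  have -> : I = lshift n j by apply: val_inj.
  apply: (smooth_on_eq hSA (f := a j)) => // u Du.
  by rewrite chart_coord_lshift (vf_comps_xcoord j Xab).
have -> : I = rshift n j by apply: val_inj.
apply: (smooth_on_eq hSA (f := b j)) => // u Du.
by rewrite chart_coord_rshift (vf_comps_ycoord j Xab).
Qed.

Lemma smooth_on_act X a b f : vf_comps X a b -> sm f -> sm (fun u => X u f).
Proof. by move=> /vf_comps_field fX sf; apply: (field_on_act hSA). Qed.

Lemma vf_comps_is_vfield X a b u : vf_comps X a b -> D u -> is_vfield_at A u X.
Proof.
move=> Xab Du; have [Dc Do] := rD; split.
  exists c, (coord (a := SA) c @` D); split.
    split; [exact: Dc|exact: Do|by exists u|].
    by move=> _ [v /Dc ? <-]; exists v.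
  by move=> z /(region_image hSA rD)[Dz _]; apply: vf_comps_tangent Xab Dz.
move=> f sf; have [D1 [rD1 D1u sf1]] := smooth_at_on hSA (Dc _ Du) sf.
have rD' := region_cap hSA rD rD1.
apply: (smooth_on_at rD') => //; apply: (field_on_act hSA) => //.
  by apply: field_on_sub (vf_comps_field Xab) => v [].
by apply: smooth_on_sub sf1 => v [].
Qed.

Lemma is_vfield_comps X : (forall u, D u -> is_vfield_at A u X) ->
  vf_comps X (fun i u => X u (xcoord c i)) (fun i u => X u (ycoord c i)).
Proof.
move=> hX; have [Dc _] := rD.
have sX f : sm f -> sm (fun u => X u f).
  move=> sf; apply: (smooth_on_local hSA rD) => u Du.
  by have [_] := hX u Du; apply; apply: smooth_on_at sf.
split=> [i|i|u Du].
- exact/sX/smooth_on_xcoord.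
- exact/sX/smooth_on_ycoord.
- apply: tangent_vec => //; have [[d [V [[du _ Vu _]]]] + _] := hX u Du.
  by move=> /(_ _ Vu); rewrite (paramK hSA du).
Qed.

Lemma pi_comps_is_pifield U a u : pi_comps U a -> D u -> is_pifield_at A u U.
Proof.
move=> Ua Du; have [Dc Do] := rD; split.
  exists c, (coord (a := SA) c @` D); split.
    split; [exact: Dc|exact: Do|by exists u|].
    by move=> _ [v /Dc ? <-]; exists v.
  by move=> z /(region_image hSA rD)[Dz _]; apply: pi_comps_tangent Ua Dz.
move=> f sf; have cu := region_base Du.
have [E [rE Eu sfE]] := smooth_at_on hA cu sf.
have rD' := region_cap hSA rD (region_over rE).
have Du' : (D `&` over E) u by split=> //; split=> //; exact: region_slit.
apply: (smooth_on_at rD' Du').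
apply: (smooth_on_eq hSA (f := fun v => \sum_k a k v * partial c k f v.1)) => //.
  move=> v [Dv [_ Ev]].
  rewrite (tangentE hA (pi_comps_tangent Ua Dv) (region_base Dv)).
    by apply: eq_bigr => k _; rewrite (pi_comps_chart_coord k Ua).
  exact: smooth_on_at sfE.
apply: (smooth_on_sum rD' _ _ (F := fun k v => a k v * partial c k f v.1)) => k.
apply: (smooth_on_mul rD').
  by have [+ _] := Ua => /(_ k); apply: smooth_on_sub => v [].
have : smooth_on (B := SA) c (over E) (fun v => partial c k f v.1).
  by apply: smooth_on_fst => //; apply: smooth_on_partial.
by apply: smooth_on_sub => v [].
Qed.

Lemma is_pifield_comps U : (forall u, D u -> is_pifield_at A u U) ->
  pi_comps U (fun i u => U u (chart_coord c i)).
Proof.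
move=> hU; split=> [i|u Du].
  apply: (smooth_on_local hSA rD) => u Du.
  have [_] := hU u Du; apply; apply: (smooth_at_chart_coord hA).
  exact: region_base.
apply: tangent_pivec => //; have [[d [V [[du _ Vu _]]]] + _] := hU u Du.
by move=> /(_ _ Vu); rewrite (paramK hSA du).
Qed.

Lemma vf_comps_eq X a b a' b' : vf_comps X a b ->
  (forall i u, D u -> a i u = a' i u) -> (forall i u, D u -> b i u = b' i u) ->
  vf_comps X a' b'.
Proof.
move=> [sa sb XE] aE bE; split=> [i|i|u Du].
- by apply: smooth_on_eq (sa i) => // u; exact: aE.
- by apply: smooth_on_eq (sb i) => // u; exact: bE.
- have -> : a'^~ u = a^~ u by apply/funext => i; rewrite aE.
  have -> : b'^~ u = b^~ u by apply/funext => i; rewrite bE.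
  exact: XE.
Qed.

Lemma pi_comps_eq U a a' : pi_comps U a -> (forall i u, D u -> a i u = a' i u) ->
  pi_comps U a'.
Proof.
move=> [sa UE] aE; split=> [i|u Du].
  by apply: smooth_on_eq (sa i) => // u; exact: aE.
have -> : a'^~ u = a^~ u by apply/funext => i; rewrite aE.
exact: UE.
Qed.

Lemma pi_comps_ext U U' a : pi_comps U a -> (forall u, D u -> U u = U' u) ->
  pi_comps U' a.
Proof. by move=> [sa UE] UU; split=> // u Du; rewrite -(UU u Du); exact: UE. Qed.

Lemma vf_comps_ext X X' a b : vf_comps X a b -> (forall u, D u -> X u = X' u) ->
  vf_comps X' a b.
Proof. by move=> [sa sb XE] XX; split=> // u Du; rewrite -(XX u Du); exact: XE. Qed.

Lemma vec_linear (s t : R) p q p' q' u : D u ->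
  (fun f => s * vec c p q u f + t * vec c p' q' u f) =
  vec c (fun i => s * p i + t * p' i) (fun i => s * q i + t * q' i) u.
Proof.
move=> Du; rewrite /vec (chart_vec_linear hSA); last by case: rD => + _; apply.
apply: (congr1 (fun w => chart_vec (A := SA) c w u)).
rewrite !scale_row_mx add_row_mx.
by congr row_mx; apply/rowP => i; rewrite !mxE.
Qed.

Lemma pivec_linear (s t : R) p p' u : D u ->
  (fun f => s * pivec c p u f + t * pivec c p' u f) =
  pivec c (fun i => s * p i + t * p' i) u.
Proof.
move=> Du; rewrite /pivec (chart_vec_linear hA); last exact: region_base.
apply: (congr1 (fun w => chart_vec (A := A) c w u.1)).
by apply/rowP => i; rewrite !mxE.
Qed.

Lemma vf_comps_linear (s t : R) X Y a b a' b' : vf_comps X a b -> vf_comps Y a' b' ->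
  vf_comps (fun u f => s * X u f + t * Y u f)
    (fun i u => s * a i u + t * a' i u) (fun i u => s * b i u + t * b' i u).
Proof.
move=> [sa sb XE] [sa' sb' YE]; have cst k := smooth_on_cst rD k.
split=> [i|i|u Du]; try by apply: (smooth_on_add rD); apply: (smooth_on_mul rD).
by rewrite (XE u Du) (YE u Du) vec_linear.
Qed.

Lemma pi_comps_linear (f g : TB R M -> R) U V a b : sm f -> sm g ->
  pi_comps U a -> pi_comps V b ->
  pi_comps (fun u h => f u * U u h + g u * V u h)
    (fun i u => f u * a i u + g u * b i u).
Proof.
move=> sf sg [sa UE] [sb VE]; split=> [i|u Du].
  by apply: (smooth_on_add rD); apply: (smooth_on_mul rD).
by rewrite (UE u Du) (VE u Du) pivec_linear.
Qed.

Lemma pi_comps_fmul (f : TB R M -> R) U a : sm f -> pi_comps U a ->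
  pi_comps (fun u h => f u * U u h) (fun i u => f u * a i u).
Proof.
move=> sf Ua; have s0 := smooth_on_cst rD 0.
apply: (pi_comps_eq (pi_comps_ext (pi_comps_linear sf s0 Ua Ua) _)) => [u Du|i u Du].
  by apply/funext => h; rewrite mul0r addr0.
by rewrite mul0r addr0.
Qed.

Lemma pi_comps_add U V a b : pi_comps U a -> pi_comps V b ->
  pi_comps (fun u h => U u h + V u h) (fun i u => a i u + b i u).
Proof.
move=> Ua Vb; have s1 := smooth_on_cst rD 1.
apply: (pi_comps_eq (pi_comps_ext (pi_comps_linear s1 s1 Ua Vb) _)) => [u Du|i u Du].
  by apply/funext => h; rewrite !mul1r.
by rewrite !mul1r.
Qed.

Lemma pi_comps_subr U V a b : pi_comps U a -> pi_comps V b ->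
  pi_comps (fun u h => U u h - V u h) (fun i u => a i u - b i u).
Proof.
move=> Ua Vb; have s1 := smooth_on_cst rD 1; have sN1 := smooth_on_cst rD (-1).
apply: (pi_comps_eq (pi_comps_ext (pi_comps_linear s1 sN1 Ua Vb) _)) => [u Du|i u Du].
  by apply/funext => h; rewrite mul1r mulN1r.
by rewrite mul1r mulN1r.
Qed.

Lemma eta_comps : pi_comps (@eta R M) (ycoord c).
Proof.
split=> [i|u Du]; first exact: smooth_on_ycoord.
by apply: (tangent_pivec (t := u.2)) => //; have [] := region_slit Du.
Qed.

(** In the induced chart the line t -> u + t U(u) in the fibre is the straight line from the
    coordinates of u in direction (0, p). *)
Lemma gamma_vec u U p : D u -> U u = pivec c p u ->
  gamma A U u = vec c (fun=> 0) p u.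
Proof.
move=> Du UE; have [Dc _] := rD; have su := region_slit Du.
have cu := region_base Du; have [tu _] := su.
apply/funext => f; rewrite /gamma /vec /chart_vec /on_smooth.
case: asboolP => // sf.
rewrite derive1E /derive.
(* The difference quotients agree for every h, even where u + h U(u) is the zero vector, because
   [slit_param] is total. *)
apply: (congr1 (fun F : R -> R^o => lim (F @ 0^'))); apply/funext => h /=.
rewrite (slit_paramK su cu) [h *: 1]mulr1 addr0.
have -> : (fun g => u.2 g + 0 * U u g) = u.2.
  by apply/funext => g; rewrite mul0r addr0.
rewrite -surjective_pairing; congr (_ *: (f _ - f u)).
rewrite /slit_param.
have xE : lsubmx (h *: row_mx (\row__ 0) (\row_i p i) + slit_coord c u) = coord c u.1.
  rewrite scale_row_mx add_row_mx row_mxKl (_ : \row__ 0 = 0) ?scaler0 ?add0r //.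
  by apply/rowP => i; rewrite !mxE.
rewrite xE (paramK hA cu); congr (_, _).
rewrite scale_row_mx add_row_mx row_mxKr UE /pivec.
have u2E := tangent_chart hA tu cu.
transitivity (fun g => 1 * chart_vec c (\row_i u.2 (chart_coord c i)) u.1 g +
                       h * chart_vec c (\row_i p i) u.1 g).
  by apply/funext => g; rewrite mul1r -[in RHS]u2E.
by rewrite (chart_vec_linear hA _ _ _ _ cu) scale1r [_ *: _ + _]addrC.
Qed.

Lemma gamma_comps U a : pi_comps U a -> vf_comps (gamma A U) (fun _ _ => 0) a.
Proof.
move=> [sa UE]; split=> // [i|u Du]; first exact: (smooth_on_cst rD).
exact/gamma_vec/UE.
Qed.

Lemma rho_pivec u X p q : D u -> X u = vec c p q u -> rho A X u = pivec c p u.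
Proof.
move=> Du XE; have su := region_slit Du; have cu := region_base Du.
have tX : tangent SA u (X u) by rewrite XE; apply: vec_tangent.
apply/funext => g; rewrite /rho /pivec /chart_vec /on_smooth.
case: asboolP => // sg; rewrite (tangent_fst tX su cu sg).
have [E [rE Eu sgE]] := smooth_at_on hA cu sg.
rewrite derive_sum_basis; last first.
  by apply: (smooth_differentiable sgE); exists u.1.
by apply: eq_bigr => i _; rewrite XE vec_xcoord // mxE partialE.
Qed.

Lemma rho_comps X a b : vf_comps X a b -> pi_comps (rho A X) a.
Proof. by move=> [sa sb XE]; split=> // u Du; exact/rho_pivec/XE. Qed.

Lemma bracket_comps X Y a b a' b' : vf_comps X a b -> vf_comps Y a' b' ->
  vf_comps (bracket A X Y) (fun i u => X u (a' i) - Y u (a i))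
                           (fun i u => X u (b' i) - Y u (b i)).
Proof.
move=> Xab Yab; have [sa sb XE] := Xab; have [sa' sb' YE] := Yab.
have sX f : sm f -> sm (fun u => X u f) := smooth_on_act Xab.
have sY f : sm f -> sm (fun u => Y u f) := smooth_on_act Yab.
split=> [i|i|u Du]; try by apply: (smooth_on_sub_fun rD); [apply: sX|apply: sY].
have e := bracket_chart hSA rD (vf_comps_field Xab) (vf_comps_field Yab) Du.
apply: etrans e _; apply: (congr1 (fun w => chart_vec (A := SA) c w u)).
apply/rowP => I; rewrite mxE.
have tX := vf_comps_tangent Xab Du; have tY := vf_comps_tangent Yab Du.
case: (splitP I) => j Ij.
  have -> : I = lshift n j by apply: val_inj.
  rewrite row_mxEl mxE !chart_coord_lshift.
  rewrite (tangent_eq_on hSA tX (g := a' j) rD) // => [|v Dv].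
    rewrite (tangent_eq_on hSA tY (g := a j) rD) // => v Dv.
    exact: vf_comps_xcoord Xab Dv.
  exact: vf_comps_xcoord Yab Dv.
have -> : I = rshift n j by apply: val_inj.
rewrite row_mxEr mxE !chart_coord_rshift.
rewrite (tangent_eq_on hSA tX (g := b' j) rD) // => [|v Dv].
  rewrite (tangent_eq_on hSA tY (g := b j) rD) // => v Dv.
  exact: vf_comps_ycoord Xab Dv.
exact: vf_comps_ycoord Yab Dv.
Qed.

End Components.

End SlitBundle.

(** * The canonical spray *)

(** The rate of change of a function of degree 2, such as E, under the dilation u -> (1 + t) u. *)
Lemma derive1_dilation (R : realType) (e : R) :
  derive1 (fun t : R => (1 + t) ^+ 2 * e) 0 = 2 * e.
Proof.
pose h : R -> R := cst 1 + id.
have d1 : is_derive (0 : R) 1 h (0 + 1) by exact: is_deriveD.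
have d2 := is_deriveZ e (is_deriveM d1 d1).
rewrite derive1E (_ : (fun t => _) = e *: (h * h)); last first.
  apply/funext => t; rewrite mulrC expr2; reflexivity.
rewrite derive_val /h -[(_ + _ : R -> R) 0]/(1 + 0) addr0 add0r.
by rewrite [1 *: 1]mulr1 [_ *: _]mulrC.
Qed.

Lemma sum_delta (R : pzRingType) (n : nat) (j : 'I_n) (F : 'I_n -> R) :
  \sum_i (j == i)%:R * F i = F j.
Proof.
rewrite (bigD1 j) //= eqxx mul1r big1 ?addr0 // => i ij.
by rewrite eq_sym (negbTE ij) mul0r.
Qed.

Section FinslerSpray.
Context {R : realType} {n : nat} {M : Type} {A : atlas R n M} (hA : regular A).
Implicit Types (c : chart A) (u : TB R M) (D : set (TB R M)).

Local Notation SA := (slit_atlas A).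

Let hSA := regular_slit hA.

Lemma vf_comps_sub c D D' X a b : D' `<=` D -> vf_comps (c := c) (D := D) X a b ->
  vf_comps (c := c) (D := D') X a b.
Proof.
move=> DD [sa sb XE]; split=> [i|i|u /DD]; last exact: XE.
  exact: smooth_on_sub DD (sa i).
exact: smooth_on_sub DD (sb i).
Qed.

(** Nondegeneracy of Omega and the horizontal map involve fields known only near u; D is shrunk
    around u until such a field has components. *)
Lemma is_vfield_at_comps c D u X : region (B := SA) c D -> D u ->
  is_vfield_at A u X ->
  exists D', [/\ region (B := SA) c D', D' u, D' `<=` D &
    vf_comps (c := c) (D := D') X
      (fun i v => X v (xcoord c i)) (fun i v => X v (ycoord c i))].
Proof.
move=> rD Du [[d [V [nV tV]]] sX]; have [Dc _] := rD; have cu := Dc _ Du.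
have [D1 [rD1 D1u D1d D1V]] := chart_nbhd_region hSA cu nV.
have [D2 [rD2 D2u sD2]] := smooth_at_on_all hSA cu
  (fun i => sX _ (smooth_on_at rD Du (smooth_on_xcoord hA rD i))).
have [D3 [rD3 D3u sD3]] := smooth_at_on_all hSA cu
  (fun i => sX _ (smooth_on_at rD Du (smooth_on_ycoord hA rD i))).
have rD' := region_cap hSA (region_cap hSA rD rD1) (region_cap hSA rD2 rD3).
exists ((D `&` D1) `&` (D2 `&` D3)); split=> //; first by move=> v [[]].
split=> [i|i|v Dv].
- by apply: smooth_on_sub (sD2 i) => v [_ []].
- by apply: smooth_on_sub (sD3 i) => v [_ []].
- apply: (tangent_vec hA rD' _ Dv); have [[_ D1v] _] := Dv.
  by have := tV _ (D1V v D1v); rewrite (paramK hSA (D1d _ D1v)).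
Qed.

Context {L : TB R M -> R} (hL : finsler A L).

Local Notation E := (energy L).

Section Region.
Context {c : chart A} {D : set (TB R M)} (rD : region (B := SA) c D).

Local Notation sm f := (smooth_on (B := SA) c D f).

Lemma smooth_on_energy : sm E.
Proof.
have sL : sm L.
  apply: (smooth_on_local hSA rD) => u Du; have [_ sL _ _] := hL.
  by apply: sL; exact: (region_slit rD).
rewrite (_ : E = fun u => 2^-1 * (L u * L u)); last by apply/funext.
apply: (smooth_on_mul rD); first exact: (smooth_on_cst rD).
exact: (smooth_on_mul rD).
Qed.

Let sE := smooth_on_energy.

Lemma eulerE f u : D u -> sm f ->
  gamma A (@eta R M) u f = \sum_k ycoord c k u * dy c k f u.
Proof.
by move=> Du sf; exact: (vertical_act hA rD (gamma_comps hA rD (eta_comps hA rD)) Du sf).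
Qed.

Lemma euler_energy u : D u -> \sum_k ycoord c k u * dy c k E u = 2 * E u.
Proof.
move=> Du; rewrite -(eulerE Du sE) /gamma /on_smooth.
rewrite asboolT; last exact: smooth_on_at sE.
have [_ _ homL _] := hL.
rewrite derive1E (near_eq_derive (g := fun t : R => (1 + t) ^+ 2 * E u)); last first.
  (* Homogeneity of L holds for positive factors only, here for 1 + t. *)
  have t0 : \forall t \near (0 : R), -1 < t by apply: lt_nbhsr; rewrite oppr_lt0.
  move: t0; apply: filterS => t t1.
  have -> : (fun g => u.2 g + t * eta u g) = (fun g => (1 + t) * u.2 g).
    by apply/funext => g; rewrite mulrDl mul1r.
  rewrite /energy homL; [|exact: (region_slit rD)|lra].
  by rewrite exprMn; ring.
by rewrite -derive1E derive1_dilation.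
Qed.

(** When Euler's identity is differentiated in y^j, the factor y^j contributes one extra derivative
    of f, so the degree drops by one. In [euler_dx] the factors y^i are constant in x and the degree
    stays. *)
Lemma euler_dy f (k : R) j u : sm f ->
    (forall v, D v -> \sum_i ycoord c i v * dy c i f v = k * f v) -> D u ->
  \sum_i ycoord c i u * dy c i (dy c j f) u = (k - 1) * dy c j f u.
Proof.
move=> sf fk Du; have sdy i : sm (dy c i f) by apply: smooth_on_dy.
have sby i : sm (ycoord c i) by apply: smooth_on_ycoord.
have := dy_eq hA rD j Du fk.
rewrite (dy_mul hA rD _ Du (smooth_on_cst rD k) sf) dy_cst mul0r add0r.
rewrite (dy_sum hA rD) // => [|i]; last exact: (smooth_on_mul rD).
move=> e; rewrite mulrBl mul1r -e -[X in _ = _ - X](sum_delta j (fun i => dy c i f u)).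
rewrite -sumrB; apply: eq_bigr => i _.
rewrite (dy_mul hA rD) // (dy_ycoord hA rD) // (dy_comm hA rD j i) //.
by rewrite addrAC subrr add0r.
Qed.

Lemma euler_dx f (k : R) j u : sm f ->
    (forall v, D v -> \sum_i ycoord c i v * dy c i f v = k * f v) -> D u ->
  \sum_i ycoord c i u * dy c i (dx c j f) u = k * dx c j f u.
Proof.
move=> sf fk Du; have sdy i : sm (dy c i f) by apply: smooth_on_dy.
have sby i : sm (ycoord c i) by apply: smooth_on_ycoord.
have := dx_eq hA rD j Du fk.
rewrite (dx_mul hA rD _ Du (smooth_on_cst rD k) sf) dx_cst mul0r add0r.
rewrite (dx_sum hA rD) // => [|i]; last exact: (smooth_on_mul rD).
move=> <-; apply: eq_bigr => i _.
rewrite (dx_mul hA rD) // (dx_ycoord hA rD) // mul0r add0r.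
by rewrite (dx_dy_comm hA rD).
Qed.

Lemma dJ_energy X a b u : vf_comps (c := c) (D := D) X a b -> D u ->
  dJ A E X u = \sum_i a i u * dy c i E u.
Proof.
move=> Xab Du; have JX := gamma_comps hA rD (rho_comps hA rD Xab).
exact: (vertical_act hA rD JX Du sE).
Qed.

(** Omega is the exterior derivative of the 1-form (dE/dy^i) dx^i, so the derivatives of the
    components of X and Y cancel against the bracket. *)
Lemma Omega_comps X Y a b a' b' u : vf_comps (c := c) (D := D) X a b ->
    vf_comps (c := c) (D := D) Y a' b' -> D u ->
  Omega A L X Y u =
    \sum_i a' i u * X u (dy c i E) - \sum_i a i u * Y u (dy c i E).
Proof.
move=> Xab Yab Du; have sdy i : sm (dy c i E) by apply: smooth_on_dy.
have [sa sb _] := Xab; have [sa' sb' _] := Yab.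
have tX := vf_comps_tangent rD Xab Du; have tY := vf_comps_tangent rD Yab Du.
rewrite /Omega (tangent_eq_on hSA tX rD Du (fun v Dv => dJ_energy Yab Dv)).
rewrite (tangent_eq_on hSA tY rD Du (fun v Dv => dJ_energy Xab Dv)).
rewrite (dJ_energy (bracket_comps hA rD Xab Yab) Du).
rewrite (tangent_sum hSA tX rD Du) => [|i]; last exact: (smooth_on_mul rD).
rewrite (tangent_sum hSA tY rD Du) => [|i]; last exact: (smooth_on_mul rD).
rewrite -!sumrB; apply: eq_bigr => i _.
by rewrite (tangent_mul hSA tX rD Du) // (tangent_mul hSA tY rD Du) //; ring.
Qed.

Lemma vec_cst_comps p q : vf_comps (c := c) (D := D) (vec c p q)
  (fun i _ => p i) (fun i _ => q i).
Proof. by split=> // i; exact: (smooth_on_cst rD). Qed.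

End Region.

Section Spray.
Context {c : chart A} {D : set (TB R M)} (rD : region (B := SA) c D).

Local Notation sm f := (smooth_on (B := SA) c D f).

Let sE : sm E. Proof. exact: smooth_on_energy. Qed.
Let sdy i f : sm f -> sm (dy c i f). Proof. exact: smooth_on_dy. Qed.
Let sdx i f : sm f -> sm (dx c i f). Proof. exact: smooth_on_dx. Qed.

(** For the vertical field s^i d/dy^i, Omega against Y is the Hessian of E contracted with s and the
    x-components of Y. A kernel vector of the Hessian thus annihilates Omega and vanishes by the
    Finsler axiom. *)
Lemma hessian_nondegenerate (s : 'I_n -> R) u : D u ->
  (forall j, \sum_i s i * dy c i (dy c j E) u = 0) -> forall i, s i = 0.
Proof.
move=> Du s0 i; pose X := vec c (fun=> 0) s.
have Xs : vf_comps (D := D) X _ _ := vec_cst_comps rD (fun=> 0) s.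
have X0 : X u = fun=> 0.
  have [_ _ _ nd] := hL; apply: nd; first exact: (region_slit rD).
    exact: vf_comps_is_vfield Xs Du.
  move=> Y hY; have [D' [rD' D'u DD' Yab]] := is_vfield_at_comps rD Du hY.
  rewrite (Omega_comps rD' (vf_comps_sub DD' Xs) Yab D'u).
  rewrite [X in _ - X]big1 => [|j _]; last exact: mul0r.
  rewrite subr0; apply: big1 => j _.
  rewrite (vf_comps_act hA rD Xs Du (sdy j sE)) s0 addr0.
  by rewrite big1 ?mulr0 // => k _; rewrite mul0r.
by rewrite -(vf_comps_ycoord hA rD i Xs Du) X0.
Qed.

Context {G : vfield R M} (hG : canonical_spray A L G).

Lemma spray_comps : exists g : 'I_n -> TB R M -> R,
  vf_comps (c := c) (D := D) G (ycoord c) g /\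
  forall i u, D u -> \sum_k ycoord c k u * dy c k (g i) u = 2 * g i u.
Proof.
have [vG sprayG] := hG.
pose a i u := G u (xcoord c i); pose g i u := G u (ycoord c i).
have Gag : vf_comps (c := c) (D := D) G a g.
  apply: (is_vfield_comps hA rD) => u Du.
  exact: vG (region_slit rD Du).
have [sa sg _] := Gag.
have euE : forall v, D v -> \sum_i ycoord c i v * dy c i E v = 2 * E v.
  by move=> v Dv; apply: (euler_energy rD).
have eu_dy j v : D v -> \sum_i ycoord c i v * dy c i (dy c j E) v = dy c j E v.
  by move=> Dv; rewrite (euler_dy rD j sE euE Dv) (_ : 2 - 1 = 1) ?mul1r //; ring.
(* The spray equation on d/dy^j gives a^i E_ij = dE/dy^j, with E_ij the Hessian in y. By Euler y^i
   E_ij has the same value, so a - y is in the kernel of the Hessian. *)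
have aE i u : D u -> a i u = ycoord c i u.
  move=> Du; apply/eqP; rewrite -subr_eq0; apply/eqP.
  apply: (hessian_nondegenerate Du (s := fun i => a i u - ycoord c i u)) => j.
  have Vj := vec_cst_comps rD (fun=> 0) (fun i => (j == i)%:R).
  have := sprayG u _ (region_slit rD Du) (vf_comps_is_vfield hA rD Vj Du).
  rewrite (Omega_comps rD Gag Vj Du) [X in X - _]big1 => [|i' _]; last exact: mul0r.
  rewrite sub0r /act (vf_comps_act hA rD Vj Du sE) sum_delta.
  rewrite [X in - (X + _)]big1 ?add0r => [|i' _]; last exact: mul0r.
  move/oppr_inj => e.
  under eq_bigr => i' _ do rewrite mulrBl.
  rewrite sumrB eu_dy // -e; apply/eqP; rewrite subr_eq0; apply/eqP.
  apply: eq_bigr => i' _; congr (_ * _).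
  rewrite (vf_comps_act hA rD Vj Du (sdy i' sE)) sum_delta.
  rewrite [X in _ = X + _]big1 ?add0r => [|k _]; last exact: mul0r.
  by rewrite (dy_comm hA rD).
have Gyg : vf_comps (c := c) (D := D) G (ycoord c) g by exact: vf_comps_eq Gag _ _.
exists g; split=> // i u Du.
(* The spray equation on d/dx^j: Omega contributes -y^i d/dx^j (dE/dy^i), which is -2 dE/dx^j by
   Euler, and the right-hand side is -dE/dx^j. *)
have Gdy j v : D v -> G v (dy c j E) = dx c j E v.
  move=> Dv; have Vj := vec_cst_comps rD (fun i => (j == i)%:R) (fun=> 0).
  have := sprayG v _ (region_slit rD Dv) (vf_comps_is_vfield hA rD Vj Dv).
  rewrite (Omega_comps rD Gyg Vj Dv) sum_delta /act.
  rewrite (vf_comps_act hA rD Vj Dv sE) sum_delta.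
  rewrite [X in - (_ + X)]big1 ?addr0 => [|i' _]; last exact: mul0r.
  rewrite (eq_bigr (fun k => ycoord c k v * dy c k (dx c j E) v)) => [|k _]; last first.
    rewrite (vf_comps_act hA rD Vj Dv (sdy k sE)) sum_delta.
    rewrite [X in _ + X]big1 ?addr0 => [|k' _]; last exact: mul0r.
    by rewrite (dx_dy_comm hA rD).
  rewrite (euler_dx rD j sE euE Dv) => e; lra.
apply/eqP; rewrite -subr_eq0; apply/eqP.
apply: (hessian_nondegenerate Du
  (s := fun i => \sum_k ycoord c k u * dy c k (g i) u - 2 * g i u)) => j.
pose C := gamma A (@eta R M).
have Ceta : vf_comps (D := D) C _ _ := gamma_comps hA rD (eta_comps hA rD).
have tC : tangent SA u (C u) := vf_comps_tangent rD Ceta Du.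
have CE f : sm f -> C u f = \sum_k ycoord c k u * dy c k f u by exact: eulerE.
have sy i' : sm (ycoord c i') by exact: smooth_on_ycoord.
(* The Euler field C is applied to both sides of [Gdy], with G expanded in components. *)
have : C u (fun v => \sum_i ycoord c i v * dx c i (dy c j E) v +
                     \sum_i g i v * dy c i (dy c j E) v) = C u (dx c j E).
  apply: (tangent_eq_on (regular_slit hA) tC rD Du) => v Dv.
  by rewrite -(vf_comps_act hA rD Gyg Dv (sdy j sE)) Gdy.
rewrite (CE (dx c j E)) ?(euler_dx rD j sE euE Du); last exact: sdx.
rewrite (tangent_add (regular_slit hA) tC rD Du); first last.
- apply: (smooth_on_sum rD) => k; apply: (smooth_on_mul rD) => //.
  by do 2 apply: sdy.
- apply: (smooth_on_sum rD) => k; apply: (smooth_on_mul rD) => //.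
  by apply: sdx; apply: sdy.
have eu1 v : D v -> \sum_i ycoord c i v * dy c i (dy c j E) v = 1 * dy c j E v.
  by move=> Dv; rewrite mul1r eu_dy.
rewrite !(tangent_sum (regular_slit hA) tC rD Du); first last.
- by move=> k; apply: (smooth_on_mul rD) => //; apply: sdx; apply: sdy.
- by move=> k; apply: (smooth_on_mul rD) => //; apply: sdy; apply: sdy.
(* Both factors have degree 1, hence the 2. In [C2] the Hessian has degree 0, so only g is
   differentiated. *)
have C1 i' : C u (fun v => ycoord c i' v * dx c i' (dy c j E) v) =
    2 * (ycoord c i' u * dx c i' (dy c j E) u).
  have sxy : sm (dx c i' (dy c j E)) by apply: sdx; apply: sdy.
  rewrite (tangent_mul (regular_slit hA) tC rD Du (sy i') sxy).
  rewrite (vf_comps_ycoord hA rD i' Ceta Du) (CE _ sxy).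
  by rewrite (euler_dx rD i' (sdy j sE) eu1 Du) mul1r; ring.
have C2 i' : C u (fun v => g i' v * dy c i' (dy c j E) v) =
    (\sum_k ycoord c k u * dy c k (g i') u) * dy c i' (dy c j E) u.
  have syy : sm (dy c i' (dy c j E)) by apply: sdy; apply: sdy.
  rewrite (tangent_mul (regular_slit hA) tC rD Du (sg i') syy) (CE _ syy).
  by rewrite (euler_dy rD i' (sdy j sE) eu1 Du) subrr mul0r mulr0 addr0 CE.
rewrite (eq_bigr _ (fun i' _ => C1 i')) [X in _ + X](eq_bigr _ (fun i' _ => C2 i')).
(* The right-hand side is 2 dE/dx^j, that is 2 G(dE/dy^j); its x-part equals the sum from [C1], and
   only Hessian terms remain. *)
rewrite -(Gdy j u Du) (vf_comps_act hA rD Gyg Du (sdy j sE)) -mulr_sumr mulrDr => e.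
have e2 := addrI _ e.
under eq_bigr => i' _ do rewrite mulrBl -mulrA.
by rewrite sumrB -mulr_sumr -e2 subrr.
Qed.

End Spray.

End FinslerSpray.

(** * The Berwald connection and its curvature *)

Section BerwaldConnection.
Context {R : realType} {n : nat} {M : Type} {A : atlas R n M} (hA : regular A).
Context {G : vfield R M} {c : chart A} {g : 'I_n -> TB R M -> R}.

Local Notation SA := (slit_atlas A).

Let hSA := regular_slit hA.

(* With G = y^i d/dx^i + g^i d/dy^i, i.e. g^i = - 2 G^i in the usual notation:
   [ncoef i k] is N_i^k, [bcoef i j k] is G_{ij}^k, and [rcoef i j k] is the
   k-th component of the value of the torsion R^ at (d/dx^i, d/dx^j). *)
Definition ncoef (i k : 'I_n) : TB R M -> R := fun u => - 2^-1 * dy c i (g k) u.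
Definition bcoef (i j k : 'I_n) : TB R M -> R := dy c j (ncoef i k).
(** The horizontal derivative usually written delta/delta x^i, the action of beta(d/dx^i) on
    functions ([horizontal_act]). *)
Definition hder (i : 'I_n) (f : TB R M -> R) : TB R M -> R :=
  fun u => dx c i f u - \sum_m ncoef i m u * dy c m f u.
Definition rcoef (i j k : 'I_n) : TB R M -> R :=
  fun u => hder j (ncoef i k) u - hder i (ncoef j k) u.

Section Region.
Context {D : set (TB R M)} (rD : region (B := SA) c D).
Context (Gg : vf_comps (c := c) (D := D) G (ycoord c) g).
Implicit Types (a b x y z : 'I_n -> TB R M -> R) (u : TB R M).
Implicit Types (V W : vfield R M) (X Y Z U : pifield R M).

Local Notation sm f := (smooth_on (B := SA) c D f).
Local Notation vfc := (vf_comps (c := c) (D := D)).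
Local Notation pic := (pi_comps (c := c) (D := D)).

Let sg i : sm (g i). Proof. by have [_ + _] := Gg; apply. Qed.
Let sdx i f : sm f -> sm (dx c i f). Proof. exact: smooth_on_dx. Qed.
Let sdy i f : sm f -> sm (dy c i f). Proof. exact: smooth_on_dy. Qed.
Let sM f f' : sm f -> sm f' -> sm (fun u => f u * f' u).
Proof. exact: smooth_on_mul. Qed.
Let sB f f' : sm f -> sm f' -> sm (fun u => f u - f' u).
Proof. exact: smooth_on_sub_fun. Qed.
Let sS (F : 'I_n -> TB R M -> R) : (forall i, sm (F i)) -> sm (fun u => \sum_i F i u).
Proof. by move=> sF; apply: smooth_on_sum. Qed.
Let sC (k : R) : sm (fun=> k). Proof. exact: smooth_on_cst. Qed.

Lemma smooth_ncoef i k : sm (ncoef i k).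
Proof. by apply: sM => //; apply: sdy. Qed.

Lemma smooth_bcoef i j k : sm (bcoef i j k).
Proof. by apply: sdy; apply: smooth_ncoef. Qed.

Lemma smooth_hder i f : sm f -> sm (hder i f).
Proof.
move=> sf; apply: sB; first exact: sdx.
by apply: sS => m; apply: sM; [exact: smooth_ncoef|exact: sdy].
Qed.

Lemma smooth_rcoef i j k : sm (rcoef i j k).
Proof. by apply: sB; apply: smooth_hder; apply: smooth_ncoef. Qed.

(** Up to the factor -1/2 these are second y-derivatives of g^k. *)
Lemma bcoef_sym i j k u : D u -> bcoef i j k u = bcoef j i k u.
Proof.
move=> Du; rewrite /bcoef /ncoef.
have sdg i' j' : sm (dy c i' (g j')) by apply: sdy.
rewrite !(dy_mul hA rD _ Du (sC _) (sdg _ _)) !dy_cst.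
by rewrite !mul0r (dy_comm hA rD j i Du (sg k)).
Qed.

(** The terms G(a^k) of the two brackets cancel, so Gamma is tensorial. It sends d/dx^i to d/dx^i +
    (dg^k/dy^i) d/dy^k; halving in h gives the factor -1/2 of [ncoef]. *)
Lemma barthel_comps W a b : vfc W a b ->
  vfc (barthel A G W) a (fun k u => \sum_i a i u * dy c i (g k) u - b k u).
Proof.
move=> Wab; have JW := gamma_comps hA rD (rho_comps hA rD Wab).
have BG := bracket_comps hA rD Wab Gg.
have JB := gamma_comps hA rD (rho_comps hA rD BG).
have JWG := bracket_comps hA rD JW Gg.
have lin := vf_comps_linear hA rD 1 (-1) JWG JB.
apply: vf_comps_eq (vf_comps_ext lin _) _ _ => //.
- by move=> u Du; apply/funext => f; rewrite mul1r mulN1r.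
- move=> i u Du; rewrite (vf_comps_ycoord hA rD i JW Du) mulr0 addr0 mul1r.
  by rewrite (tangent_cst hSA (vf_comps_tangent rD Gg Du) rD Du) subr0.
- move=> k u Du; rewrite (vertical_act hA rD JW Du (sg k)).
  rewrite (vf_comps_ycoord hA rD k Wab Du); ring.
Qed.

Lemma hproj_comps W a b : vfc W a b ->
  vfc (hproj A G W) a (fun k u => - \sum_i a i u * ncoef i k u).
Proof.
move=> Wab; have lin := vf_comps_linear hA rD 2^-1 2^-1 Wab (barthel_comps Wab).
apply: vf_comps_eq (vf_comps_ext lin _) _ _ => //.
- by move=> u Du; apply/funext => f; rewrite -mulrDr.
- by move=> i u Du; rewrite -mulrDl; lra.
- move=> k u Du; rewrite -mulrDr addrC subrK mulr_sumr -sumrN.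
  by apply: eq_bigr => i _; rewrite /ncoef; ring.
Qed.

Lemma vproj_comps W a b : vfc W a b ->
  vfc (vproj A G W) (fun _ _ => 0) (fun k u => b k u + \sum_i a i u * ncoef i k u).
Proof.
move=> Wab; have lin := vf_comps_linear hA rD 2^-1 (- 2^-1) Wab (barthel_comps Wab).
apply: vf_comps_eq (vf_comps_ext lin _) _ _ => //.
- by move=> u Du; apply/funext => f; rewrite mulNr -mulrBr.
- by move=> i u Du; rewrite mulNr subrr.
- move=> k u Du; have half (p q : R) : 2^-1 * p + - 2^-1 * (q - p) = p - 2^-1 * q.
    by lra.
  rewrite half mulr_sumr -sumrN; congr (_ + _).
  by apply: eq_bigr => i _; rewrite /ncoef; ring.
Qed.

End Region.

Context {beta : pifield R M -> vfield R M} {K : vfield R M -> pifield R M}.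
Context (hbeta : horizontal_map A G beta) (hK : connector A G K).

Section Connection.
Context {D : set (TB R M)} (rD : region (B := SA) c D).
Context (Gg : vf_comps (c := c) (D := D) G (ycoord c) g).
Implicit Types (a b x y z : 'I_n -> TB R M -> R) (u : TB R M).
Implicit Types (V W : vfield R M) (X Y Z U : pifield R M).

Local Notation sm f := (smooth_on (B := SA) c D f).
Local Notation vfc := (vf_comps (c := c) (D := D)).
Local Notation pic := (pi_comps (c := c) (D := D)).

Let sg i : sm (g i). Proof. by have [_ + _] := Gg; apply. Qed.
Let sdx i f : sm f -> sm (dx c i f). Proof. exact: smooth_on_dx. Qed.
Let sdy i f : sm f -> sm (dy c i f). Proof. exact: smooth_on_dy. Qed.
Let sM f f' : sm f -> sm f' -> sm (fun u => f u * f' u).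
Proof. exact: smooth_on_mul. Qed.
Let sN f : sm f -> sm (fun u => - f u).
Proof. exact: smooth_on_opp. Qed.
Let sS (F : 'I_n -> TB R M -> R) : (forall i, sm (F i)) -> sm (fun u => \sum_i F i u).
Proof. by move=> sF; apply: smooth_on_sum. Qed.
Let sC (k : R) : sm (fun=> k). Proof. exact: smooth_on_cst. Qed.
Let snc i k : sm (ncoef i k). Proof. exact: (smooth_ncoef rD Gg). Qed.
Let sbc i j k : sm (bcoef i j k). Proof. exact: (smooth_bcoef rD Gg). Qed.

Lemma connector_comps W a b : vfc W a b ->
  pic (K W) (fun k u => b k u + \sum_i a i u * ncoef i k u).
Proof.
move=> Wab; have vW := vproj_comps rD Gg Wab.
have hW u : D u -> is_vfield_at A u W by exact: vf_comps_is_vfield Wab.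
have KW := is_pifield_comps hA rD
  (fun u Du => (hK (region_slit rD Du) (hW u Du)).1).
apply: (pi_comps_eq hA rD KW) => k u Du.
(* K W is specified only through gamma (K W), whose y-components are the components of K W. *)
have gKW := gamma_comps hA rD KW.
rewrite -(vf_comps_ycoord hA rD k gKW Du) -(vf_comps_ycoord hA rD k vW Du).
by have [_ ->] := hK (region_slit rD Du) (hW u Du).
Qed.

Lemma horizontal_comps U x : pic U x ->
  vfc (beta U) x (fun k u => - \sum_i x i u * ncoef i k u).
Proof.
move=> Ux; have hU u : D u -> is_pifield_at A u U by exact: pi_comps_is_pifield Ux.
have [sx UE] := Ux.
split=> [//|k|u Du]; first by apply: sN; apply: sS => i; apply: sM.
have [_ [W hW bE] rbE] := hbeta (region_slit rD Du) (hU u Du).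
(* The witness W changes with u and has components only near u; just their values at u enter. Its
   x-components are forced by rho (beta U) = U, and the projector determines the rest. *)
have [D' [rD' D'u DD' Wab]] := is_vfield_at_comps hA rD Du hW.
have hWab := hproj_comps rD' (vf_comps_sub DD' Gg) Wab.
have xE i : W u (xcoord c i) = x i u.
  rewrite -(pi_comps_chart_coord hA rD i Ux Du) -rbE.
  have [_ _ /(_ u D'u) hE] := hWab.
  by rewrite (rho_pivec hA rD Du (etrans bE hE)) (pivec_chart_coord hA rD).
rewrite bE; have [_ _ ->] := hWab; last exact: D'u.
rewrite (_ : (fun i => W u (xcoord c i)) = x^~ u); last by apply/funext.
rewrite (_ : (fun i => - _) = (fun k => - \sum_i x i u * ncoef i k u)) //.
by apply/funext => k; congr (- _); apply: eq_bigr => i _; rewrite xE.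
Qed.

(** The connection matrix a^i G_{il}^k of the Berwald connection along a field with x-components
    a. *)
Definition cform a l k : TB R M -> R := fun u => \sum_i a i u * bcoef i l k u.

(** The N-terms of the vertical and horizontal parts of W cancel, which leaves W acting on the
    components of Y. The connection matrix comes from gamma Y differentiating N in the horizontal
    bracket. *)
Lemma berwald_comps W a b Y y : vfc W a b -> pic Y y ->
  pic (berwald A beta K W Y) (fun k u => W u (y k) + \sum_l cform a l k u * y l u).
Proof.
move=> Wab Yy; have [sa sb _] := Wab; have [sy _] := Yy.
have gKW := gamma_comps hA rD (connector_comps Wab).
have bY := horizontal_comps Yy.
have gY := gamma_comps hA rD Yy.
have brW := horizontal_comps (rho_comps hA rD Wab).
have part1 := rho_comps hA rD (bracket_comps hA rD gKW bY).
have part2 := connector_comps (bracket_comps hA rD brW gY).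
have lin := pi_comps_linear hA rD (sC 1) (sC 1) part1 part2.
apply: (pi_comps_eq hA rD (pi_comps_ext lin _)).
  by move=> u Du; apply/funext => f; rewrite /berwald !mul1r.
move=> k u Du; rewrite !mul1r.
have tgY := vf_comps_tangent rD gY Du.
rewrite (tangent_cst hSA (vf_comps_tangent rD bY Du) rD Du) subr0.
rewrite (tangent_opp hSA tgY rD Du); last by apply: sS => i; apply: sM.
rewrite (tangent_sum hSA tgY rD Du) => [|i]; last exact: sM.
rewrite (vertical_act hA rD gKW Du (sy k)).
rewrite (vf_comps_act hA rD brW Du (sy k)) (vf_comps_act hA rD Wab Du (sy k)).
rewrite opprK.
have e0 : \sum_i (beta (rho A W) u (fun=> 0) - gamma A Y u (a i)) * ncoef i k u =
          - \sum_i gamma A Y u (a i) * ncoef i k u.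
  rewrite -sumrN; apply: eq_bigr => i _.
  by rewrite (tangent_cst hSA (vf_comps_tangent rD brW Du) rD Du) sub0r mulNr.
rewrite e0.
have e1 : \sum_i gamma A Y u (fun q => a i q * ncoef i k q) =
    \sum_i gamma A Y u (a i) * ncoef i k u + \sum_l cform a l k u * y l u.
  under [X in _ = _ + X]eq_bigr => l _ do rewrite /cform mulr_suml.
  rewrite [X in _ = _ + X]exchange_big /= -big_split /=; apply: eq_bigr => i _.
  rewrite (tangent_mul hSA tgY rD Du) //; congr (_ + _).
  rewrite (vertical_act hA rD gY Du (snc i k)).
  by rewrite mulr_sumr; apply: eq_bigr => l _; rewrite /bcoef; ring.
rewrite e1.
have e2 : \sum_i (b i u + \sum_i0 a i0 u * ncoef i0 i u) * dy c i (y k) u =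
    \sum_i b i u * dy c i (y k) u +
    \sum_i (\sum_i0 a i0 u * ncoef i0 i u) * dy c i (y k) u.
  by rewrite -big_split /=; apply: eq_bigr => i _; rewrite mulrDl.
have e3 : \sum_i (- \sum_i0 a i0 u * ncoef i0 i u) * dy c i (y k) u =
    - \sum_i (\sum_i0 a i0 u * ncoef i0 i u) * dy c i (y k) u.
  by rewrite -sumrN; apply: eq_bigr => i _; rewrite mulNr.
rewrite e2 e3.
ring.
Qed.

Lemma smooth_cform a l k : (forall i, sm (a i)) -> sm (cform a l k).
Proof. by move=> sa; apply: sS => i; apply: sM. Qed.

Lemma act_cform V b' a x l k u : vfc V x b' -> (forall i, sm (a i)) -> D u ->
  V u (cform a l k) = \sum_i V u (a i) * bcoef i l k u +
                      \sum_i a i u * V u (bcoef i l k).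
Proof.
move=> Vx sa Du; have tV := vf_comps_tangent rD Vx Du.
rewrite (tangent_sum hSA tV rD Du) => [|i]; last exact: sM.
rewrite -big_split /=; apply: eq_bigr => i _.
by rewrite (tangent_mul hSA tV rD Du).
Qed.

Lemma act_berwald V W a b a' b' z k u : vfc V a b -> vfc W a' b' ->
    (forall i, sm (z i)) -> D u ->
  V u (fun q => W q (z k) + \sum_l cform a' l k q * z l q) =
  V u (fun q => W q (z k)) +
  \sum_l (V u (cform a' l k) * z l u + cform a' l k u * V u (z l)).
Proof.
move=> Va Wa sz Du; have tV := vf_comps_tangent rD Va Du; have [sa' _ _] := Wa.
have scf l : sm (cform a' l k) by exact: smooth_cform.
rewrite (tangent_add hSA tV rD Du); first last.
- by apply: sS => l; apply: sM.
- exact: (smooth_on_act hA rD Wa (sz k)).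
rewrite (tangent_sum hSA tV rD Du) => [|l]; last exact: sM.
by congr (_ + _); apply: eq_bigr => l _; rewrite (tangent_mul hSA tV rD Du).
Qed.

Lemma sum_mul_exchange (F : 'I_n -> R) (H : 'I_n -> 'I_n -> R) (z : 'I_n -> R)
    (w : 'I_n -> R) :
  \sum_m F m * (w m + \sum_l H l m * z l) =
  \sum_l F l * w l + \sum_l z l * \sum_m F m * H l m.
Proof.
under eq_bigr => m _ do rewrite mulrDr.
rewrite big_split /=; congr (_ + _).
under eq_bigr => m _ do rewrite mulr_sumr.
rewrite exchange_big /=; apply: eq_bigr => l _; rewrite mulr_sumr.
by apply: eq_bigr => m _; ring.
Qed.

(** The structure equation for [cform], with the sign convention of [curvature]. All derivatives of
    z cancel, the second-order ones against the bracket; so do the derivatives of a and a', absorbed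
    by the connection matrix along the bracket. *)
Lemma curvature_comps V W a b a' b' Z z : vfc V a b -> vfc W a' b' -> pic Z z ->
  pic (curvature A beta K V W Z) (fun k u => \sum_l z l u *
    (\sum_i a i u * W u (bcoef i l k) - \sum_i a' i u * V u (bcoef i l k)
     + (\sum_m cform a' m k u * cform a l m u
        - \sum_m cform a m k u * cform a' l m u))).
Proof.
move=> Vab Wab Zz; have [sa sb _] := Vab; have [sa' sb' _] := Wab.
have [sz _] := Zz.
have VWZ := berwald_comps Vab (berwald_comps Wab Zz).
have WVZ := berwald_comps Wab (berwald_comps Vab Zz).
have BZ := berwald_comps (bracket_comps hA rD Vab Wab) Zz.
have lin := pi_comps_linear hA rD (sC 1) (sC 1)
  (pi_comps_linear hA rD (sC (-1)) (sC 1) VWZ WVZ) BZ.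
apply: (pi_comps_eq hA rD (pi_comps_ext lin _)).
  by move=> u Du; apply/funext => f; rewrite /curvature !mul1r mulN1r.
move=> k u Du; rewrite !mul1r mulN1r.
rewrite (act_berwald k Vab Wab sz Du) (act_berwald k Wab Vab sz Du).
rewrite !sum_mul_exchange.
have -> : bracket A V W u (z k) = V u (fun q => W q (z k)) - W u (fun q => V q (z k)).
  by rewrite /bracket /on_smooth asboolT //; exact: (smooth_on_at rD Du (sz k)).
have cE l : cform (fun i q => V q (a' i) - W q (a i)) l k u =
    \sum_i V u (a' i) * bcoef i l k u - \sum_i W u (a i) * bcoef i l k u.
  by rewrite -sumrB; apply: eq_bigr => i _; rewrite mulrBl.
under [X in _ + (_ + X)]eq_bigr => l _ do rewrite cE.
under [X in - (_ + X + _)]eq_bigr => l _ do rewrite (act_cform l k Vab sa' Du).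
under [X in _ + (_ + X + _) + _]eq_bigr => l _ do rewrite (act_cform l k Wab sa Du).
move: (V u (fun q => W q (z k))) (W u (fun q => V q (z k))) => vw wv.
have combine (F1 F2 F3 F4 F5 F6 F7 : 'I_n -> R) :
    - (vw + \sum_l F1 l + (\sum_l F2 l + \sum_l F3 l)) +
    (wv + \sum_l F4 l + (\sum_l F5 l + \sum_l F6 l)) + (vw - wv + \sum_l F7 l) =
    \sum_l (F4 l + F5 l + F6 l + F7 l - F1 l - F2 l - F3 l).
  by rewrite !sumrB !big_split /=; ring.
by rewrite combine; apply: eq_bigr => l _; ring.
Qed.

Lemma horizontal_act X x f u : pic X x -> D u -> sm f ->
  beta X u f = \sum_i x i u * hder i f u.
Proof.
move=> Xx Du sf; rewrite (vf_comps_act hA rD (horizontal_comps Xx) Du sf).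
under [X in _ + X]eq_bigr => m _ do rewrite mulNr mulr_suml.
rewrite sumrN exchange_big /= -sumrB; apply: eq_bigr => i _.
rewrite /hder mulrBr mulr_sumr; congr (_ - _).
by apply: eq_bigr => m _; rewrite -[LHS]mulrA.
Qed.

(** The defect of commutation comes from the dependence of N_j^m on y. *)
Lemma dy_hder l j f u : sm f -> D u ->
  dy c l (hder j f) u = hder j (dy c l f) u - \sum_m bcoef j l m u * dy c m f u.
Proof.
move=> sf Du; have sp m : sm (fun v => ncoef j m v * dy c m f v).
  by apply: sM; [exact: snc|exact: sdy].
rewrite /hder (dy_add hA rD) //; last by apply: sN; apply: sS.
  rewrite (dy_opp hA rD) //; last exact: sS.
  rewrite (dy_sum hA rD) // -(dx_dy_comm hA rD) // -addrA -opprD; congr (_ - _).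
  rewrite -big_split /=; apply: eq_bigr => m _.
  rewrite (dy_mul hA rD) //; last exact: sdy.
  by rewrite (dy_comm hA rD l m) // addrC.
exact: sdx.
Qed.

(** The right-hand side is the curvature matrix of [curvature_comps] for the fields beta(d/dx^i) and
    beta(d/dx^j); the commutation defects supply its quadratic terms. Hence R is a vertical
    derivative of R^. *)
Lemma dy_rcoef i j k l u : D u -> dy c l (rcoef i j k) u =
  hder j (bcoef i l k) u - hder i (bcoef j l k) u +
  (\sum_m bcoef j m k u * bcoef i l m u - \sum_m bcoef i m k u * bcoef j l m u).
Proof.
move=> Du; have sh i' j' k' : sm (hder i' (ncoef j' k')).
  by apply: (smooth_hder rD Gg); exact: snc.
rewrite /rcoef (dy_add hA rD) //; last exact: sN.
rewrite (dy_opp hA rD) // !dy_hder //.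
have mulC i' j' : \sum_m bcoef i' l m u * dy c m (ncoef j' k) u =
    \sum_m bcoef j' m k u * bcoef i' l m u.
  by apply: eq_bigr => m _; rewrite mulrC.
rewrite !mulC /bcoef; ring.
Qed.

Lemma Rcurv_comps X Y Z x y z : pic X x -> pic Y y -> pic Z z ->
  pic (Rcurv A beta K X Y Z) (fun k u =>
    \sum_l z l u * \sum_i \sum_j x i u * y j u * dy c l (rcoef i j k) u).
Proof.
move=> Xx Yy Zz.
have RXYZ := curvature_comps (horizontal_comps Xx) (horizontal_comps Yy) Zz.
apply: (pi_comps_eq hA rD RXYZ) => k u Du.
apply: eq_bigr => l _; congr (_ * _).
have e1 (f : 'I_n -> TB R M -> R) : (forall i, sm (f i)) ->
    \sum_i x i u * beta Y u (f i) = \sum_i \sum_j x i u * y j u * hder j (f i) u.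
  move=> sf; apply: eq_bigr => i _; rewrite (horizontal_act Yy Du (sf i)) mulr_sumr.
  by apply: eq_bigr => j _; rewrite mulrA.
have e2 (f : 'I_n -> TB R M -> R) : (forall i, sm (f i)) ->
    \sum_j y j u * beta X u (f j) = \sum_i \sum_j x i u * y j u * hder i (f j) u.
  move=> sf; rewrite exchange_big /=; apply: eq_bigr => j _.
  rewrite (horizontal_act Xx Du (sf j)) mulr_sumr.
  by apply: eq_bigr => i _; rewrite mulrCA mulrA.
rewrite (e1 (fun i => bcoef i l k)) ?(e2 (fun i => bcoef i l k)) //.
have e3 : \sum_m cform y m k u * cform x l m u =
    \sum_i \sum_j x i u * y j u * \sum_m bcoef j m k u * bcoef i l m u.
  under eq_bigr => m _ do rewrite /cform mulr_sumr.
  rewrite exchange_big /=; apply: eq_bigr => i _.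
  under eq_bigr => m _ do rewrite mulr_suml.
  rewrite exchange_big /=; apply: eq_bigr => j _; rewrite mulr_sumr.
  by apply: eq_bigr => m _; ring.
have e4 : \sum_m cform x m k u * cform y l m u =
    \sum_i \sum_j x i u * y j u * \sum_m bcoef i m k u * bcoef j l m u.
  under eq_bigr => m _ do rewrite /cform mulr_suml.
  rewrite exchange_big /=; apply: eq_bigr => i _.
  under eq_bigr => m _ do rewrite mulr_sumr.
  rewrite exchange_big /=; apply: eq_bigr => j _; rewrite mulr_sumr.
  by apply: eq_bigr => m _; ring.
rewrite e3 e4 -!sumrB -big_split /=; apply: eq_bigr => i _.
rewrite -!sumrB -big_split /=; apply: eq_bigr => j _ /=.
by rewrite dy_rcoef //; ring.
Qed.

(** * Bianchi identity, homogeneity and the torsion R^ *)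

Definition curv x y z k : TB R M -> R := fun u =>
  \sum_l z l u * \sum_i \sum_j x i u * y j u * dy c l (rcoef i j k) u.

Lemma rcoef_antisym i j k u : rcoef i j k u = - rcoef j i k u.
Proof. by rewrite /rcoef [RHS]opprB. Qed.

(** After [dy_rcoef] there are six derivative terms and six quadratic ones; they cancel in pairs
    because G_{ij}^k is symmetric in i and j. *)
Lemma bianchi i j l k u : D u ->
  dy c l (rcoef i j k) u + dy c i (rcoef j l k) u + dy c j (rcoef l i k) u = 0.
Proof.
move=> Du.
have hs l' i' j' : hder l' (bcoef i' j' k) u = hder l' (bcoef j' i' k) u.
  rewrite /hder (dx_eq hA rD l' Du (bcoef_sym rD Gg i' j' k)); congr (_ - _).
  apply: eq_bigr => m _; congr (_ * _).
  exact: (dy_eq hA rD m Du (bcoef_sym rD Gg i' j' k)).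
have ss i' j' l' : \sum_m bcoef i' m k u * bcoef j' l' m u =
    \sum_m bcoef i' m k u * bcoef l' j' m u.
  by apply: eq_bigr => m _; rewrite (bcoef_sym rD Gg j' l' m Du).
rewrite !dy_rcoef // (hs i j l) (hs j i l) (hs l i j).
rewrite (ss l j i) (ss j i l) (ss i l j); ring.
Qed.

Context (euler_g : forall i u, D u -> \sum_k ycoord c k u * dy c k (g i) u = 2 * g i u).

(** One degree less than g. The factor 1 is kept so that the statement can be fed to [euler_dx] and
    [euler_dy] with k = 1. *)
Lemma euler_ncoef i k u : D u ->
  \sum_m ycoord c m u * dy c m (ncoef i k) u = 1 * ncoef i k u.
Proof.
move=> Du; have sdg : sm (dy c i (g k)) by exact: sdy.
under eq_bigr => m _ do
  rewrite /ncoef (dy_mul hA rD m Du (sC _) sdg) dy_cst mul0r add0r mulrCA.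
by rewrite -mulr_sumr (euler_dy hA rD i (sg k) (euler_g k) Du) /ncoef; ring.
Qed.

(** The derivative in x keeps the degree 1 of N, and in the correction N_j^m has degree 1 while the
    y-derivative of N has degree 0. *)
Lemma euler_hder j i k u : D u ->
  \sum_m ycoord c m u * dy c m (hder j (ncoef i k)) u = hder j (ncoef i k) u.
Proof.
move=> Du; pose C := gamma A (@eta R M).
have Ceta : vfc C _ _ := gamma_comps hA rD (eta_comps hA rD).
have tC := vf_comps_tangent rD Ceta Du.
have CE f : sm f -> C u f = \sum_k ycoord c k u * dy c k f u by exact: eulerE.
have sp m : sm (fun v => ncoef j m v * dy c m (ncoef i k) v).
  by apply: sM; [exact: snc|apply: sdy; exact: snc].
have sdxN : sm (dx c j (ncoef i k)) by apply: sdx; exact: snc.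
rewrite -CE; last by apply: (smooth_hder rD Gg); exact: snc.
rewrite (tangent_sub hSA tC rD Du sdxN) ?(tangent_sum hSA tC rD Du) //; last exact: sS.
rewrite (CE _ sdxN) (euler_dx hA rD j (snc i k) (euler_ncoef i k) Du) mul1r.
congr (_ - _); apply: eq_bigr => m _.
have sdN : sm (dy c m (ncoef i k)) by apply: sdy; exact: snc.
rewrite (tangent_mul hSA tC rD Du) // !CE // euler_ncoef // mul1r.
by rewrite (euler_dy hA rD m (snc i k) (euler_ncoef i k) Du) subrr mul0r mulr0 addr0.
Qed.

Lemma euler_rcoef i j k u : D u ->
  \sum_l ycoord c l u * dy c l (rcoef i j k) u = rcoef i j k u.
Proof.
move=> Du; have sh i' j' k' : sm (hder i' (ncoef j' k')).
  by apply: (smooth_hder rD Gg); exact: snc.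
rewrite /rcoef -[in RHS](euler_hder j i k Du) -[in RHS](euler_hder i j k Du) -sumrB.
apply: eq_bigr => l _.
by rewrite (dy_add hA rD) ?(dy_opp hA rD) ?mulrBr //; exact: sN.
Qed.

Definition torsion x y k : TB R M -> R :=
  fun u => \sum_i \sum_j x i u * y j u * rcoef i j k u.

(** Inserting eta contracts the vertical derivative of [rcoef] with y^l, and Euler's identity in
    degree 1 removes the derivative. *)
Lemma Rhat_comps X Y x y : pic X x -> pic Y y ->
  pic (Rhat A beta K X Y) (torsion x y).
Proof.
move=> Xx Yy; have Reta := Rcurv_comps Xx Yy (eta_comps hA rD).
apply: (pi_comps_eq hA rD Reta) => k u Du; rewrite /torsion.
under eq_bigr => l _ do rewrite mulr_sumr.
rewrite exchange_big /=; apply: eq_bigr => i _.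
under eq_bigr => l _ do rewrite mulr_sumr.
rewrite exchange_big /=; apply: eq_bigr => j _.
rewrite -(euler_rcoef i j k Du) mulr_sumr.
by apply: eq_bigr => l _; ring.
Qed.

(** The connection matrix involves the x-components of the direction, and gamma X has none. *)
Lemma vertical_berwald X Y x y : pic X x -> pic Y y ->
  pic (berwald A beta K (gamma A X) Y) (fun k u => gamma A X u (y k)).
Proof.
move=> Xx Yy; have bXY := berwald_comps (gamma_comps hA rD Xx) Yy.
apply: (pi_comps_eq hA rD bXY) => k u Du.
rewrite [X in _ + X]big1 ?addr0 // => l _.
by rewrite /cform big1 ?mul0r // => i _; rewrite mul0r.
Qed.

(** The bracket of gamma X and gamma Y is gamma of D_{gamma X} Y - D_{gamma Y} X. For f = k this is
    the symmetry of the second vertical covariant derivative. *)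
Lemma vertical_commutator X Y x y f u : pic X x -> pic Y y -> sm f -> D u ->
  gamma A X u (fun v => gamma A Y v f) - gamma A Y u (fun v => gamma A X v f) =
  gamma A (berwald A beta K (gamma A X) Y) u f -
  gamma A (berwald A beta K (gamma A Y) X) u f.
Proof.
move=> Xx Yy sf Du.
have gX := gamma_comps hA rD Xx; have gY := gamma_comps hA rD Yy.
have gXY := gamma_comps hA rD (vertical_berwald Xx Yy).
have gYX := gamma_comps hA rD (vertical_berwald Yy Xx).
have -> : gamma A X u (fun v => gamma A Y v f) - gamma A Y u (fun v => gamma A X v f) =
    bracket A (gamma A X) (gamma A Y) u f.
  by rewrite /bracket /on_smooth asboolT //; exact: (smooth_on_at rD Du sf).
rewrite (vf_comps_act hA rD (bracket_comps hA rD gX gY) Du sf).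
rewrite (vertical_act hA rD gXY Du sf) (vertical_act hA rD gYX Du sf) -sumrB.
rewrite [X in X + _]big1 => [|i _]; last first.
  rewrite (tangent_cst hSA (vf_comps_tangent rD gX Du) rD Du).
  by rewrite (tangent_cst hSA (vf_comps_tangent rD gY Du) rD Du) subrr mul0r.
by rewrite add0r; apply: eq_bigr => i _; rewrite mulrBl.
Qed.

Lemma smooth_torsion x y k : (forall i, sm (x i)) -> (forall i, sm (y i)) ->
  sm (torsion x y k).
Proof.
move=> sx sy; apply: sS => i; apply: sS => j; apply: sM; first exact: sM.
exact: (smooth_rcoef rD Gg).
Qed.

(** The components of D_{gamma Z} R^ = R: the last two terms are the Leibniz terms of the arguments
    X and Y. *)
Lemma act_torsion Z x y z k u : pic Z z -> (forall i, sm (x i)) ->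
    (forall i, sm (y i)) -> D u ->
  gamma A Z u (torsion x y k) = curv x y z k u +
    torsion (fun i v => gamma A Z v (x i)) y k u +
    torsion x (fun i v => gamma A Z v (y i)) k u.
Proof.
move=> Zz sx sy Du; have gZ := gamma_comps hA rD Zz.
have tZ := vf_comps_tangent rD gZ Du.
have sr i j : sm (rcoef i j k) by exact: (smooth_rcoef rD Gg).
have st i : sm (fun v => \sum_j x i v * y j v * rcoef i j k v).
  by apply: sS => j; apply: sM => //; apply: sM.
rewrite (tangent_sum hSA tZ rD Du) //.
have -> : curv x y z k u = \sum_i \sum_j x i u * y j u *
    \sum_l z l u * dy c l (rcoef i j k) u.
  rewrite /curv; under eq_bigr => l _ do rewrite mulr_sumr.
  rewrite exchange_big /=; apply: eq_bigr => i _.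
  under eq_bigr => l _ do rewrite mulr_sumr.
  rewrite exchange_big /=; apply: eq_bigr => j _; rewrite mulr_sumr.
  by apply: eq_bigr => l _; rewrite mulrCA.
rewrite /torsion -!big_split /=; apply: eq_bigr => i _.
rewrite (tangent_sum hSA tZ rD Du) => [|j]; last by apply: sM => //; apply: sM.
rewrite -!big_split /=; apply: eq_bigr => j _.
rewrite (tangent_mul hSA tZ rD Du) //; last exact: sM.
rewrite (tangent_mul hSA tZ rD Du) // (vertical_act hA rD gZ Du (sr i j)).
move: (\sum_l _) (gamma A Z u (x i)) (gamma A Z u (y j)) (rcoef i j k u) => s1 s2 s3 s4.
ring.
Qed.

Lemma torsion_antisym x y k u : torsion x y k u = - torsion y x k u.
Proof.
rewrite /torsion exchange_big /= -sumrN; apply: eq_bigr => j _.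
by rewrite -sumrN; apply: eq_bigr => i _; rewrite rcoef_antisym; ring.
Qed.

(** The Bianchi identity contracted with eta, R(eta, Y)X - R(eta, X)Y = R(X, Y)eta, the right-hand
    side being R^(X, Y) by Euler's identity. *)
Lemma torsion_bianchi x y k u : D u ->
  curv (ycoord c) y x k u - curv (ycoord c) x y k u = torsion x y k u.
Proof.
move=> Du; rewrite /curv /torsion.
have -> : \sum_l y l u * \sum_i \sum_j ycoord c i u * x j u * dy c l (rcoef i j k) u =
    \sum_l \sum_j x l u * y j u * \sum_i ycoord c i u * dy c j (rcoef i l k) u.
  rewrite [RHS]exchange_big /=; apply: eq_bigr => j _.
  rewrite [X in _ * X]exchange_big /= mulr_sumr; apply: eq_bigr => l _.
  by rewrite !mulr_sumr; apply: eq_bigr => i _; ring.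
rewrite -sumrB; apply: eq_bigr => l _.
rewrite [X in _ * X]exchange_big /= mulr_sumr -sumrB; apply: eq_bigr => j _.
rewrite -(euler_rcoef l j k Du) !mulr_sumr -sumrB; apply: eq_bigr => i _.
have dN : dy c j (rcoef l i k) u = - dy c j (rcoef i l k) u.
  rewrite (dy_eq hA rD j Du (fun v _ => rcoef_antisym l i k v)) (dy_opp hA rD) //.
  exact: (smooth_rcoef rD Gg).
have dN' : dy c i (rcoef l j k) u = - dy c i (rcoef j l k) u.
  rewrite (dy_eq hA rD i Du (fun v _ => rcoef_antisym l j k v)) (dy_opp hA rD) //.
  exact: (smooth_rcoef rD Gg).
have := bianchi i j l k Du; rewrite dN' dN => e.
have {}e : dy c l (rcoef i j k) u = dy c j (rcoef i l k) u - dy c i (rcoef j l k) u.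
  by apply/eqP; rewrite -subr_eq0 -e; apply/eqP; ring.
by rewrite e; ring.
Qed.

End Connection.

End BerwaldConnection.

(** * The Weyl tensors *)

Section WeylTensors.
Context {R : realType} {n : nat} {M : Type} {A : atlas R n M} (hA : regular A).
Context {G : vfield R M} {c : chart A} {g : 'I_n -> TB R M -> R}.
Context {beta : pifield R M -> vfield R M} {K : vfield R M -> pifield R M}.
Context (hbeta : horizontal_map A G beta) (hK : connector A G K).

Local Notation SA := (slit_atlas A).

Let hSA := regular_slit hA.

Context {D : set (TB R M)} (rD : region (B := SA) c D).
Context (Gg : vf_comps (c := c) (D := D) G (ycoord c) g).
Context (euler_g : forall i u, D u -> \sum_k ycoord c k u * dy c k (g i) u = 2 * g i u).
Implicit Types (x y z : 'I_n -> TB R M -> R) (u : TB R M) (X Y Z U : pifield R M).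

Local Notation sm f := (smooth_on (B := SA) c D f).
Local Notation pic := (pi_comps (c := c) (D := D)).
Local Notation Dv X Y := (berwald A beta K (gamma A X) Y).
Local Notation rcoef := (rcoef (c := c) (g := g)).
Local Notation curv := (curv (c := c) (g := g)).
Local Notation torsion := (torsion (c := c) (g := g)).

Let sdy i f : sm f -> sm (dy c i f). Proof. exact: smooth_on_dy. Qed.
Let sM f f' : sm f -> sm f' -> sm (fun u => f u * f' u).
Proof. exact: smooth_on_mul. Qed.
Let sD f f' : sm f -> sm f' -> sm (fun u => f u + f' u).
Proof. exact: smooth_on_add. Qed.
Let sB f f' : sm f -> sm f' -> sm (fun u => f u - f' u).
Proof. exact: smooth_on_sub_fun. Qed.
Let sS (F : 'I_n -> TB R M -> R) : (forall i, sm (F i)) -> sm (fun u => \sum_i F i u).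
Proof. by move=> sF; apply: smooth_on_sum. Qed.
Let sC (k : R) : sm (fun=> k). Proof. exact: smooth_on_cst. Qed.

Local Ltac solve_smooth :=
  repeat first [solve [trivial] | exact: sC | apply: sM | apply: sB | apply: sD].

Lemma pi_comps_sub D' U x : D' `<=` D -> pic U x -> pi_comps (c := c) (D := D') U x.
Proof.
move=> DD [sx UE]; split=> [i|u /DD]; last exact: UE.
exact: smooth_on_sub DD (sx i).
Qed.

(** * Ricci traces in a chart *)

Lemma coord_field_comps (d : chart A) i :
  pi_comps (c := c) (D := over A (dom c `&` dom d)) (coord_field d i)
    (fun m v => partial d i (chart_coord c m) v.1).
Proof.
have rcd := region_over hA (region_dom2 hA c d).
have rdc := region_dom2 hA d c.
have sxc m : smooth_on d (dom d `&` dom c) (chart_coord c m).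
  by apply: (smooth_on_local hA rdc) => p [_ cp]; exact: smooth_at_chart_coord.
split=> [m|v [sv [cv dv]]].
  apply: (smooth_on_local hSA rcd) => v [sv [cv dv]].
  apply: (smooth_at_fst hA sv cv).
  exact: (smooth_on_at rdc (conj dv cv) (smooth_on_partial hA rdc i (sxc m))).
rewrite /pivec; have tv : tangent A v.1 (coord_field d i v).
  exact: tangent_chart_vec.
apply: etrans (tangent_chart hA tv cv) _.
apply: (congr1 (fun w => chart_vec (A := A) c w v.1)); apply/rowP => m.
by rewrite !mxE /coord_field (chart_vec_partial _ rdc (conj dv cv) (sxc m)).
Qed.

Definition ricci x y : TB R M -> R := fun u =>
  \sum_m \sum_l y l u * \sum_i x i u * dy c l (rcoef i m m) u.

(** The operator is computed in c and traced in d. The Jacobian of the change of charts and its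
    inverse multiply to the identity, so the value does not depend on d. *)
Lemma trace_in_chart (d : chart A) X Y x y u : pic X x -> pic Y y -> D u ->
  dom d u.1 ->
  \sum_i Rcurv A beta K X (coord_field d i) Y u (fun p => coord d p 0 i) =
  ricci x y u.
Proof.
move=> Xx Yy Du du; have su := region_slit rD Du; have cu := region_base rD Du.
pose D' := D `&` over A (dom c `&` dom d).
have rcd := region_over hA (region_dom2 hA c d).
have rD' : region (B := SA) c D' by exact: region_cap.
have D'u : D' u by split=> //; split.
have DD' : D' `<=` D by move=> v [].
have Gg' := vf_comps_sub DD' Gg.
have Xx' := pi_comps_sub DD' Xx; have Yy' := pi_comps_sub DD' Yy.
have cf i : pi_comps (c := c) (D := D') (coord_field d i)
    (fun m v => partial d i (chart_coord c m) v.1).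
  have [s E] := coord_field_comps d i; split=> [m|v [_ Ev]]; last exact: E.
  by apply: smooth_on_sub (s m) => v [].
pose t m k := \sum_l y l u * \sum_i x i u * dy c l (rcoef i m k) u.
have RE i : Rcurv A beta K X (coord_field d i) Y u (chart_coord d i) =
    \sum_k \sum_m partial d i (chart_coord c m) u.1 * t m k *
                   partial c k (chart_coord d i) u.1.
  have Rc := Rcurv_comps hA hbeta hK rD' Gg' Xx' (cf i) Yy'.
  rewrite (tangentE hA (pi_comps_tangent rD' Rc D'u) cu); last first.
    exact: smooth_at_chart_coord.
  apply: eq_bigr => k _; rewrite (pi_comps_chart_coord hA rD' k Rc D'u) -[RHS]mulr_suml.
  congr (_ * _); rewrite /t.
  under [RHS]eq_bigr => m _ do rewrite mulr_sumr.
  rewrite [RHS]exchange_big /=; apply: eq_bigr => l _.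
  under [RHS]eq_bigr => m _ do rewrite mulrCA.
  rewrite -mulr_sumr; congr (_ * _).
  under [RHS]eq_bigr => m _ do rewrite mulr_sumr.
  rewrite [RHS]exchange_big /=; apply: eq_bigr => i' _.
  by apply: eq_bigr => m _; ring.
under eq_bigr => i _ do rewrite RE.
rewrite exchange_big /=; apply: eq_bigr => k _.
rewrite exchange_big /= -[RHS](sum_delta k (fun m => t m k)).
apply: eq_bigr => m _.
(* The Kronecker delta is read as d/dx^k applied to x^m in c; expanding this through d yields the
   product of the two Jacobians. *)
have <- : chart_vec c (delta_mx 0 k) u.1 (chart_coord c m) = (k == m)%:R.
  by rewrite (chart_vec_chart_coord hA) // mxE eqxx eq_sym.
rewrite (tangentE hA (tangent_chart_vec _ cu) du); last exact: smooth_at_chart_coord.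
rewrite mulr_suml; apply: eq_bigr => i _.
rewrite (chart_vec_partial _ (region_dom2 hA c d) (conj cu du)); first by ring.
apply: (smooth_on_local hA (region_dom2 hA c d)) => p [_ dp].
exact: smooth_at_chart_coord.
Qed.

(** [tr] picks an unspecified element of a set of values: the chart c shows that the set is
    inhabited, and every chart gives the same value. *)
Lemma R2_comps X Y x y u : pic X x -> pic Y y -> D u ->
  R2 A beta K X Y u = ricci x y u.
Proof.
move=> Xx Yy Du; rewrite /R2 /tr.
set P := [set t | _]; have : P (get P).
  apply: (getPex (P := P)); exists (ricci x y u), c.
  split; first exact: (region_base rD Du).
  by rewrite (trace_in_chart Xx Yy Du (region_base rD Du)).
by move=> [d [du ->]]; rewrite (trace_in_chart Xx Yy Du du).
Qed.

Lemma smooth_ricci x y : (forall i, sm (x i)) -> (forall i, sm (y i)) ->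
  sm (ricci x y).
Proof.
move=> sx sy; apply: sS => m; apply: sS => l; apply: sM => //.
apply: sS => i; apply: sM => //; apply: sdy; exact: (smooth_rcoef hA rD Gg).
Qed.

Lemma smooth_R2 X Y x y : pic X x -> pic Y y -> sm (R2 A beta K X Y).
Proof.
move=> Xx Yy; have [sx _] := Xx; have [sy _] := Yy.
apply: (smooth_on_eq hSA (f := ricci x y)) => //; last exact: smooth_ricci.
by move=> u Du; rewrite (R2_comps Xx Yy Du).
Qed.

Lemma smooth_R1 X x : pic X x -> sm (R1 A beta K X).
Proof.
move=> Xx; have eta_c := eta_comps hA rD.
apply: sM; first exact: sC.
apply: sD; last exact: (smooth_R2 eta_c Xx).
apply: sM; first exact: sC.
exact: (smooth_R2 Xx eta_c).
Qed.

Lemma smooth_kscal : sm (kscal A beta K).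
Proof.
have eta_c := eta_comps hA rD.
apply: sM; first exact: sC.
exact: (smooth_R2 eta_c eta_c).
Qed.

Local Notation R1 := (R1 A beta K).
Local Notation ks := (kscal A beta K).

Lemma smooth_gamma X x f : pic X x -> sm f -> sm (fun u => gamma A X u f).
Proof. by move=> Xx; exact: (smooth_on_act hA rD (gamma_comps hA rD Xx)). Qed.

Lemma Dv_comps X Y x y : pic X x -> pic Y y ->
  pic (Dv X Y) (fun k u => gamma A X u (y k)).
Proof. by move=> Xx Yy; exact: (vertical_berwald hA hbeta hK rD Gg Xx Yy). Qed.

Lemma smooth_nR1 X Y x y : pic X x -> pic Y y ->
  sm (nabla_s1 A beta K (gamma A X) R1 Y).
Proof.
move=> Xx Yy; apply: sB; last exact: (smooth_R1 (Dv_comps Xx Yy)).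
by apply: (smooth_gamma Xx); exact: smooth_R1 Yy.
Qed.

Lemma smooth_comps X x k : pic X x -> sm (x k).
Proof. by case. Qed.

(** * The two identities in components *)

Let q : R := (n%:R + 1)^-1.

Let qE : q * (n%:R + 1) = 1.
Proof. by rewrite /q mulVf // natr1 pnatr_eq0. Qed.

(** The Leibniz rule for the shape of [w2], stated for abstract functions to keep the large actual
    terms out of the rewriting; [tangent_weyl1] serves [w1] in the same way. *)
Lemma tangent_weyl2 (t : (TB R M -> R) -> R) u (h f1 f2 f3 f4 e1 e2 e : TB R M -> R) :
  tangent SA u t -> D u -> sm h -> sm f1 -> sm f2 -> sm f3 -> sm f4 ->
  sm e1 -> sm e2 -> sm e ->
  t (fun v => h v + q * (f1 v * e1 v + f2 v * e v - (f3 v * e2 v + f4 v * e v))) =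
  t h + q * (t f1 * e1 u + f1 u * t e1 + (t f2 * e u + f2 u * t e)
             - (t f3 * e2 u + f3 u * t e2 + (t f4 * e u + f4 u * t e))).
Proof.
move=> tu Du sh sf1 sf2 sf3 sf4 se1 se2 se.
rewrite (tangent_add hSA tu rD Du) //; last solve_smooth.
rewrite (tangent_mul hSA tu rD Du) //; last solve_smooth.
rewrite (tangent_cst hSA tu rD Du) mul0r add0r.
rewrite (tangent_sub hSA tu rD Du); try solve [solve_smooth].
rewrite !(tangent_add hSA tu rD Du); try solve [solve_smooth].
by rewrite !(tangent_mul hSA tu rD Du).
Qed.

Lemma tangent_weyl1 (t : (TB R M -> R) -> R) u (h f e f1 f2 e' : TB R M -> R) (k m : R) :
  tangent SA u t -> D u -> sm h -> sm f -> sm e -> sm f1 -> sm f2 -> sm e' ->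
  t (fun v => h v - f v * e v + q * ((k * f1 v - m * f2 v) * e' v)) =
  t h - (t f * e u + f u * t e) + q * ((k * t f1 - m * t f2) * e' u +
                                       (k * f1 u - m * f2 u) * t e').
Proof.
move=> tu Du sh sf se sf1 sf2 se'.
rewrite (tangent_add hSA tu rD Du); try solve [solve_smooth].
rewrite (tangent_sub hSA tu rD Du); try solve [solve_smooth].
rewrite (tangent_mul hSA tu rD Du (sC q)); last solve_smooth.
rewrite !(tangent_mul hSA tu rD Du); try solve [solve_smooth].
rewrite (tangent_sub hSA tu rD Du); try solve [solve_smooth].
rewrite !(tangent_mul hSA tu rD Du (sC _)) // !(tangent_cst hSA tu rD Du).
by rewrite !mul0r !add0r.
Qed.

Definition w2 X Y x y k : TB R M -> R := fun u =>
  torsion x y k u + q *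
    (R1 Y u * x k u + nabla_s1 A beta K (gamma A X) R1 Y u * ycoord c k u
    - (R1 X u * y k u + nabla_s1 A beta K (gamma A Y) R1 X u * ycoord c k u)).

Lemma W2_comps X Y x y : pic X x -> pic Y y -> pic (W2 A beta K X Y) (w2 X Y x y).
Proof.
move=> Xx Yy; have eta_c := eta_comps hA rD.
have RXY := Rhat_comps hA hbeta hK rD Gg euler_g Xx Yy.
have h1 := pi_comps_add hA rD (pi_comps_fmul hA rD (smooth_R1 Yy) Xx)
  (pi_comps_fmul hA rD (smooth_nR1 Xx Yy) eta_c).
have h2 := pi_comps_add hA rD (pi_comps_fmul hA rD (smooth_R1 Xx) Yy)
  (pi_comps_fmul hA rD (smooth_nR1 Yy Xx) eta_c).
have h := pi_comps_fmul hA rD (sC q) (pi_comps_subr hA rD h1 h2).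
exact: (pi_comps_add hA rD RXY h).
Qed.

Lemma Wcurv_comps X Y Z x y z : pic X x -> pic Y y -> pic Z z ->
  pic (Wcurv A beta K X Y Z) (fun k u => curv x y z k u + q * (
    D2_1 A beta K R1 Z Y u * x k u + D2_1 A beta K R1 X Y u * z k u
    + D2_2 A beta K (D2_1 A beta K R1) Z X Y u * ycoord c k u
    - (D2_1 A beta K R1 Z X u * y k u + D2_1 A beta K R1 Y X u * z k u
    + D2_2 A beta K (D2_1 A beta K R1) Z Y X u * ycoord c k u))).
Proof.
move=> Xx Yy Zz; have eta_c := eta_comps hA rD.
have sD2 X' Y' x' y' : pic X' x' -> pic Y' y' ->
    sm (D2_2 A beta K (D2_1 A beta K R1) Z X' Y').
  move=> Xx' Yy'; apply: sB; first apply: sB.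
  - by apply: (smooth_gamma Zz); exact: smooth_nR1 Xx' Yy'.
  - exact: smooth_nR1 (Dv_comps Zz Xx') Yy'.
  - exact: smooth_nR1 Xx' (Dv_comps Zz Yy').
have RXYZ := Rcurv_comps hA hbeta hK rD Gg Xx Yy Zz.
have part X' Y' x' y' (Xx' : pic X' x') (Yy' : pic Y' y') :=
  pi_comps_add hA rD (pi_comps_add hA rD
    (pi_comps_fmul hA rD (smooth_nR1 Zz Yy') Xx')
    (pi_comps_fmul hA rD (smooth_nR1 Xx' Yy') Zz))
    (pi_comps_fmul hA rD (sD2 _ _ _ _ Xx' Yy') eta_c).
have h := pi_comps_fmul hA rD (sC q)
  (pi_comps_subr hA rD (part _ _ _ _ Xx Yy) (part _ _ _ _ Yy Xx)).
exact: (pi_comps_add hA rD RXYZ h).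
Qed.

Lemma pi_comps_inj U V x y u : pic U x -> pic V y -> D u ->
  (forall k, x k u = y k u) -> U u = V u.
Proof.
move=> [_ UE] [_ VE] Du xy; rewrite (UE u Du) (VE u Du).
by have -> : x^~ u = y^~ u by apply/funext.
Qed.

Lemma Wcurv_eq X Y Z x y z u : pic X x -> pic Y y -> pic Z z -> D u ->
  Wcurv A beta K X Y Z u = nabla_v2 A beta K (gamma A Z) (W2 A beta K) X Y u.
Proof.
move=> Xx Yy Zz Du.
have ZX := Dv_comps Zz Xx; have ZY := Dv_comps Zz Yy.
have h : pic (nabla_v2 A beta K (gamma A Z) (W2 A beta K) X Y) _ :=
  pi_comps_subr hA rD (pi_comps_subr hA rD (Dv_comps Zz (W2_comps Xx Yy))
     (W2_comps ZX Yy)) (W2_comps Xx ZY).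
apply: (pi_comps_inj (Wcurv_comps Xx Yy Zz) h Du) => k.
have gZ := gamma_comps hA rD Zz; have tZ := vf_comps_tangent rD gZ Du.
have sx i : sm (x i) by exact: (smooth_comps i Xx).
have sy i : sm (y i) by exact: (smooth_comps i Yy).
have sby i : sm (ycoord c i) by exact: smooth_on_ycoord.
have sRX := smooth_R1 Xx; have sRY := smooth_R1 Yy.
have sXY := smooth_nR1 Xx Yy; have sYX := smooth_nR1 Yy Xx.
have st : sm (torsion x y k) by exact: (smooth_torsion hA rD Gg).
have -> : gamma A Z u (w2 X Y x y k) = _ := tangent_weyl2 tZ Du st sRY sXY sRX sYX
  (sx k) (sy k) (sby k).
(* This is D_{gamma Z} eta = Z: it turns the eta-term of W_2 into the Z-term of W. *)
rewrite (vf_comps_ycoord hA rD k gZ Du).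
rewrite (act_torsion hA rD Gg k Zz sx sy Du) /w2.
have D1 U V : D2_1 A beta K R1 U V u = nabla_s1 A beta K (gamma A U) R1 V u by [].
have D1' V : nabla_s1 A beta K (gamma A Z) R1 V u =
    gamma A Z u (R1 V) - R1 (Dv Z V) u by [].
have D2 U V : D2_2 A beta K (D2_1 A beta K R1) Z U V u =
    gamma A Z u (nabla_s1 A beta K (gamma A U) R1 V) -
    nabla_s1 A beta K (gamma A (Dv Z U)) R1 V u -
    nabla_s1 A beta K (gamma A U) R1 (Dv Z V) u by [].
rewrite !D2 !D1 !D1'; cbv beta.
generalize (curv x y z k u) (torsion (fun i v => gamma A Z v (x i)) y k u)
  (torsion x (fun i v => gamma A Z v (y i)) k u)
  (R1 X u) (R1 Y u) (gamma A Z u (R1 X)) (gamma A Z u (R1 Y))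
  (R1 (Dv Z X) u) (R1 (Dv Z Y) u)
  (nabla_s1 A beta K (gamma A X) R1 Y u) (nabla_s1 A beta K (gamma A Y) R1 X u)
  (gamma A Z u (nabla_s1 A beta K (gamma A X) R1 Y))
  (gamma A Z u (nabla_s1 A beta K (gamma A Y) R1 X))
  (nabla_s1 A beta K (gamma A (Dv Z X)) R1 Y u)
  (nabla_s1 A beta K (gamma A (Dv Z Y)) R1 X u)
  (nabla_s1 A beta K (gamma A X) R1 (Dv Z Y) u)
  (nabla_s1 A beta K (gamma A Y) R1 (Dv Z X) u)
  (gamma A Z u (x k)) (gamma A Z u (y k)) (x k u) (y k u) (z k u) (ycoord c k u) q.
clear; move=> *; ring.
Qed.

Definition w1 Y y k : TB R M -> R := fun u =>
  torsion (ycoord c) y k u - ks u * y k u +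
  q * ((3 * R1 Y u - (n%:R + 1) * gamma A Y u ks) * ycoord c k u).

Lemma W1_comps Y y : pic Y y -> pic (W1 A beta K Y) (w1 Y y).
Proof.
move=> Yy; have eta_c := eta_comps hA rD.
have H := Rhat_comps hA hbeta hK rD Gg euler_g eta_c Yy.
have sY : sm (fun v => 3 * R1 Y v - (n%:R + 1) * gamma A Y v ks).
  apply: sB; apply: sM; try exact: sC; first exact: smooth_R1 Yy.
  exact: (smooth_gamma Yy smooth_kscal).
have h := pi_comps_fmul hA rD (sC q) (pi_comps_fmul hA rD sY eta_c).
exact: (pi_comps_add hA rD (pi_comps_subr hA rD H
  (pi_comps_fmul hA rD smooth_kscal Yy)) h).
Qed.

Lemma act_w1 X Y x y k u : pic X x -> pic Y y -> D u ->
  gamma A X u (w1 Y y k) - w1 (Dv X Y) (fun k v => gamma A X v (y k)) k u =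
  curv (ycoord c) y x k u + torsion x y k u - gamma A X u ks * y k u +
  q * ((3 * nabla_s1 A beta K (gamma A X) R1 Y u -
        (n%:R + 1) * (gamma A X u (fun v => gamma A Y v ks) -
                      gamma A (Dv X Y) u ks)) * ycoord c k u +
       (3 * R1 Y u - (n%:R + 1) * gamma A Y u ks) * x k u).
Proof.
move=> Xx Yy Du; have gX := gamma_comps hA rD Xx.
have tX := vf_comps_tangent rD gX Du.
have sy i : sm (y i) by exact: (smooth_comps i Yy).
have sby i : sm (ycoord c i) by exact: smooth_on_ycoord.
have sRY := smooth_R1 Yy; have sk := smooth_kscal.
have sYk := smooth_gamma Yy smooth_kscal.
have st : sm (torsion (ycoord c) y k) by exact: (smooth_torsion hA rD Gg).
have -> : gamma A X u (w1 Y y k) = _ := tangent_weyl1 3 (n%:R + 1) tX Du st sk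
  (sy k) sRY sYk (sby k).
rewrite (vf_comps_ycoord hA rD k gX Du) (act_torsion hA rD Gg k Xx sby sy Du) /w1.
(* Since D_{gamma X} eta = X, differentiating the first argument of H(Y) = R^(eta, Y) gives a full
   copy of R^(X, Y). *)
have -> : torsion (fun i v => gamma A X v (ycoord c i)) y k u = torsion x y k u.
  apply: eq_bigr => i _; apply: eq_bigr => j _.
  by rewrite (vf_comps_ycoord hA rD i gX Du).
have D1 : nabla_s1 A beta K (gamma A X) R1 Y u =
    gamma A X u (R1 Y) - R1 (Dv X Y) u by [].
rewrite D1; cbv beta.
generalize (curv (ycoord c) y x k u) (torsion x y k u)
  (torsion (ycoord c) (fun i v => gamma A X v (y i)) k u) (R1 Y u)
  (gamma A X u (R1 Y)) (R1 (Dv X Y) u) (gamma A X u ks) (ks u) (gamma A Y u ks)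
  (gamma A X u (fun v => gamma A Y v ks)) (gamma A (Dv X Y) u ks)
  (gamma A X u (y k)) (x k u) (y k u) (ycoord c k u) q.
clear; move=> *; ring.
Qed.

Lemma W2_eq X Y x y u : pic X x -> pic Y y -> D u ->
  W2 A beta K X Y u =
    (fun f => 3^-1 * (nabla_v1 A beta K (gamma A X) (W1 A beta K) Y u f
                      - nabla_v1 A beta K (gamma A Y) (W1 A beta K) X u f)).
Proof.
move=> Xx Yy Du.
have h U V a b (Ua : pic U a) (Vb : pic V b) :
    pic (nabla_v1 A beta K (gamma A U) (W1 A beta K) V) _ :=
  pi_comps_subr hA rD (Dv_comps Ua (W1_comps Vb)) (W1_comps (Dv_comps Ua Vb)).
have hXY := pi_comps_fmul hA rD (sC 3^-1)
  (pi_comps_subr hA rD (h _ _ _ _ Xx Yy) (h _ _ _ _ Yy Xx)).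
apply: (pi_comps_inj (W2_comps Xx Yy) hXY Du) => k.
rewrite (act_w1 k Xx Yy Du) (act_w1 k Yy Xx Du) /w2.
have comm := vertical_commutator hA hbeta hK rD Gg Xx Yy smooth_kscal Du.
have bianchi_xy := torsion_bianchi hA rD Gg euler_g x y k Du.
rewrite (torsion_antisym y x); move: bianchi_xy comm qE; cbv beta.
generalize (curv (ycoord c) y x k u) (curv (ycoord c) x y k u) (torsion x y k u)
  (R1 X u) (R1 Y u)
  (nabla_s1 A beta K (gamma A X) R1 Y u) (nabla_s1 A beta K (gamma A Y) R1 X u)
  (gamma A X u ks) (gamma A Y u ks)
  (gamma A X u (fun v => gamma A Y v ks)) (gamma A Y u (fun v => gamma A X v ks))
  (gamma A (Dv X Y) u ks) (gamma A (Dv Y X) u ks)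
  (x k u) (y k u) (ycoord c k u) q (n%:R + 1 : R).
clear=> cyx cxy t rx ry nxy nyx kx ky kxy kyx dxy dyx xk yk ek p m.
(* The Bianchi identity eliminates R(eta, Y)X, and the commutation rule eliminates one second
   derivative of k. *)
move=> /(canRL (subrK _)) -> /(canRL (subrK _)) -> pm.
apply: (mulfI (x := 3)); first by rewrite pnatr_eq0.
rewrite [RHS]mulVKf ?pnatr_eq0 //.
(* All that remains of k: the part with -1 comes from -k Y, the part with p m from the eta-term,
   where 1/(n + 1) meets n + 1. *)
have e : (p * m - 1) * (kx * yk - ky * xk) = 0 by rewrite pm subrr mul0r.
rewrite -[LHS]addr0 -e; ring.
Qed.

End WeylTensors.

Unset Implicit Arguments.
Unset Printing Implicit Defensive.
Local Close Scope classical_set_scope.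

Theorem theorem3p6 (R : realType) (n : nat) (M : topologicalType)
    (A : atlas R n M) (L : TB R M -> R) (G : vfield R M)
    (beta : pifield R M -> vfield R M) (K : vfield R M -> pifield R M)
    (hn : (2 < n)%N)
    (hM : smooth_manifold A) (hL : finsler A L)
    (hG : canonical_spray A L G)
    (hbeta : horizontal_map A G beta) (hK : connector A G K)
    (X Y Z : pifield R M)
    (hX : is_pifield A X) (hY : is_pifield A Y) (hZ : is_pifield A Z)
    (u : TB R M) (hu : slit A u) :
  W2 A beta K X Y u =
    (fun f => 3^-1 * (nabla_v1 A beta K (gamma A X) (W1 A beta K) Y u f
                      - nabla_v1 A beta K (gamma A Y) (W1 A beta K) X u f)) /\
  Wcurv A beta K X Y Z u =
    nabla_v2 A beta K (gamma A Z) (W2 A beta K) X Y u.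
Proof.
have hA := regular_of_manifold hM.
(* Tangency of u.2 provides a chart around u, and its whole domain serves as the region D. *)
have [[c [w [cu _]]] _] := hu.
have rD := region_dom (regular_slit hA) c.
have Du : dom (a := slit_atlas A) c u by [].
have [g [Gg euler_g]] := spray_comps hA hL rD hG.
have comps U : is_pifield A U ->
    pi_comps (c := c) (D := dom (a := slit_atlas A) c) U (fun i v => U v (chart_coord c i)).
  by move=> hU; apply: (is_pifield_comps hA rD) => v [sv _]; exact: hU.
split.
  exact: (W2_eq hA hbeta hK rD Gg euler_g (comps X hX) (comps Y hY) Du).
exact: (Wcurv_eq hA hbeta hK rD Gg euler_g (comps X hX) (comps Y hY) (comps Z hZ) Du).
Qed.
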